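(* Suppose that there exists an $(\omega_1,1)$-morass (equivalently, a simplified $(\omega_1,1)$-morass). Then there exists an atomistic $3$-ladder of cardinality $\aleph_2$.
   Context: The ambient theory is $\mathsf{ZFC}$; lattices are nonempty. Morasses. By a theorem of Velleman, for $\kappa$ regular uncountable there exists a $(\kappa,1)$-morass if and only if there exists a simplified $(\kappa,1)$-morass; the hypothesis is to be read as the existence of a simplified $(\omega_1,1)$-morass, defined as follows. Let $+$ be ordinal addition; for ordinals $\alpha\le\beta$, $\beta-\alpha$ is the unique ordinal $\xi$ with $\alpha+\xi=\beta$. For ordinals $\alpha\le\beta$ let $\tau_{\alpha,\beta}$ be the map on ordinals with $\tau_{\alpha,\beta}(\xi)=\xi$ if $\xi<\alpha$ and $\tau_{\alpha,\beta}(\xi)=\beta+(\xi-\alpha)$ if $\xi\ge\alpha$. An order-embedding between posets is a map $f$ with $f(x)\le f(y)$ iff $x\le y$. For an infinite cardinal $\kappa$, a simplified $(\kappa,1)$-morass is a structure $\bigl((\theta_\alpha\mid\alpha\le\kappa),(\mathcal{F}_{\alpha,\beta}\mid\alpha<\beta\le\kappa)\bigr)$, where the $\theta_\alpha$ are ordinals, such that: (P0) (a) $\theta_0=2$, $0<\theta_\alpha<\kappa$ for each $\alpha<\kappa$, and $\theta_\kappa=\kappa^+$; (b) $\mathcal{F}_{\alpha,\beta}$ is a set of order-embeddings from $\theta_\alpha$ into $\theta_\beta$, for all $\alpha<\beta\le\kappa$. (P1) $|\mathcal{F}_{\alpha,\beta}|<\kappa$ for all $\alpha<\beta<\kappa$.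 (P2) If $\alpha<\beta<\gamma\le\kappa$, then $\mathcal{F}_{\alpha,\gamma}=\{f\circ g\mid f\in\mathcal{F}_{\beta,\gamma},\ g\in\mathcal{F}_{\alpha,\beta}\}$. (P3) For each $\alpha<\kappa$ there exists a nonzero ordinal $\delta_\alpha<\theta_\alpha$ such that $\theta_{\alpha+1}=\theta_\alpha+(\theta_\alpha-\delta_\alpha)$ and $\mathcal{F}_{\alpha,\alpha+1}=\{\mathrm{id}_{\theta_\alpha},f_\alpha\}$, where $f_\alpha$ is the restriction of $\tau_{\delta_\alpha,\theta_\alpha}$ from $\theta_\alpha$ into $\theta_{\alpha+1}$. (P4) For every limit ordinal $\lambda\le\kappa$, all $\alpha_i<\lambda$ and $f_i\in\mathcal{F}_{\alpha_i,\lambda}$ for $i<2$, there exist $\alpha<\lambda$ with $\alpha_0,\alpha_1<\alpha$, maps $f'_i\in\mathcal{F}_{\alpha_i,\alpha}$ for $i<2$, and $g\in\mathcal{F}_{\alpha,\lambda}$ such that $f_i=g\circ f'_i$ for each $i<2$. (P5) $\theta_\alpha=\bigcup\{f[\theta_\xi]\mid \xi<\alpha,\ f\in\mathcal{F}_{\xi,\alpha}\}$ for each $\alpha$ with $0<\alpha\le\kappa$. (The requirements $\theta_0=2$ and $\delta_\alpha\neq0$ are a slight variant of the usual definition with $\theta_0=1$; one passes from the usual version to this one by adding a new zero element to each $\theta_\alpha$.) Ladders. A poset $P$ is lower finite if $\{x\in P: x\le p\}$ is finite for each $p\in P$. An element $x$ is a lower cover of $y$ if $x<y$ and there is no $z$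 with $x<z<y$. For a positive integer $k$, a $k$-ladder is a lower finite lattice in which every element has at most $k$ lower covers; it has a least element $0$. An atom is an element having $0$ as a lower cover. A lattice with $0$ is atomistic if every element is a join of atoms ($0$ being the empty join). *)

(* Defs.v *)
From HB Require Import structures.
From mathcomp Require Import all_boot all_order.
From mathcomp Require Import boolp classical_sets cardinality wochoice.

Set Implicit Arguments.
Unset Strict Implicit.
Unset Printing Implicit Defensive.

Import Order.TTheory.
Local Open Scope classical_set_scope.
Local Open Scope card_scope.
Local Open Scope order_scope.
Local Open Scope quotient_scope.

(* Ordinals are the isomorphism classes of well-ordered types. The carriers live
   in a universe below that of [Ord]; they must be small enough for [woset] to be
   a choiceType, so use plain types (nat, functions, {x | P x}) as carriers. *)
Record woset := WOSet {
  wo_sort :> Type;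
  wo_le : rel wo_sort;
  wo_leP : well_order wo_le }.

HB.instance Definition _ := gen_eqMixin woset.
HB.instance Definition _ := gen_choiceMixin woset.

Section WosetTheory.
Variable A : woset.
Implicit Types x y z : A.

Definition wo_lt x y := ~~ wo_le y x.

Lemma wo_min (P : A -> Prop) : (exists x, P x) ->
  exists2 x, P x & forall y, P y -> wo_le x y.
Proof.
move=> [x Px]; have [|z [[Pz minz] _]] := @wo_leP A (fun x => `[< P x >]).
  by exists x; apply/asboolP.
by exists z => [|y Py]; [exact/asboolP | apply/minz/asboolP].
Qed.

Lemma wo_le_total x y : wo_le x y || wo_le y x.
Proof.
have [|z [->|->] minz] := @wo_min (fun z => z = x \/ z = y).
- by exists x; left.
- by rewrite minz //; right.
- by rewrite orbC minz //; left.
Qed.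

Lemma wo_le_refl x : wo_le x x.
Proof. by rewrite -[wo_le x x]orbb wo_le_total. Qed.

Lemma wo_le_anti x y : wo_le x y -> wo_le y x -> x = y.
Proof.
move=> xy yx; have [|z [_ uniqz]] :=
    @wo_leP A (fun z => `[< z = x \/ z = y >]).
  by exists x; apply/asboolP; left.
transitivity z; [symmetry|]; apply: uniqz; split.
- by apply/asboolP; left.
- by move=> _ /asboolP[]->; rewrite // wo_le_refl.
- by apply/asboolP; right.
- by move=> _ /asboolP[]->; rewrite // wo_le_refl.
Qed.

Lemma wo_le_trans x y z : wo_le x y -> wo_le y z -> wo_le x z.
Proof.
move=> xy yz; have [|t [->|[]->] mint] :=
    @wo_min (fun t => t = x \/ t = y \/ t = z).
- by exists x; left.
- by apply: mint; right; right.
- by rewrite (wo_le_anti xy) //; apply: mint; left.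
- by rewrite -(wo_le_anti yz) //; apply: mint; auto.
Qed.

Lemma wo_ltW x y : wo_lt x y -> wo_le x y.
Proof. by move=> /negPf nyx; have := wo_le_total x y; rewrite nyx orbF. Qed.

Lemma wo_lt_le_trans x y z : wo_lt x y -> wo_le y z -> wo_lt x z.
Proof. by move=> xy yz; apply: contra xy; exact: wo_le_trans. Qed.

Lemma wo_lt_wf : well_founded wo_lt.
Proof.
move=> x; apply: contrapT => nx.
have [y ny miny] := wo_min (ex_intro (fun x => ~ Acc wo_lt x) x nx).
apply: ny; constructor=> z zy; apply: contrapT => /miny yz.
by move: zy; rewrite /wo_lt yz.
Qed.

End WosetTheory.

Section Preimage.
Variables (T : Type) (A : woset) (f : T -> A).
Hypothesis f_inj : injective f.

Lemma wo_preim_subproof : well_order (relpre f (@wo_le A)).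
Proof.
move=> P [t0 Pt0].
have [|_ [t Pt <-] mint] := @wo_min A (fun x => exists2 t, t \in P & f t = x).
  by exists (f t0), t0.
have lt t' : t' \in P -> wo_le (f t) (f t') by move=> ?; apply: mint; exists t'.
exists t; split=> [|t' [Pt' mint']]; first by split.
by apply: f_inj; apply: wo_le_anti; [exact: lt | exact: mint'].
Qed.

Definition wo_preim := WOSet wo_preim_subproof.
End Preimage.

Lemma sval_inj_subproof (A : Type) (P : pred A) :
  injective (fun u : {x | P x} => proj1_sig u).
Proof.
by move=> [x Px] [y Py] /= xy; case: _ / xy Py => Py; rewrite (bool_irrelevance Px Py).
Qed.

Definition wo_seg (A : woset) (x : A) : woset :=
  wo_preim (@sval_inj_subproof A (fun y => wo_lt y x)).

Definition sum_le (A B : woset) : rel (A + B) := fun u v =>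
  match u, v with
  | inl x, inl y => wo_le x y
  | inr x, inr y => wo_le x y
  | inl _, inr _ => true
  | inr _, inl _ => false
  end.

Lemma sum_le_subproof A B : well_order (@sum_le A B).
Proof.
apply: antisymmetric_well_order => [|P [u Pu]].
  move=> [x|x] [y|y] //= => /andP[xy yx]; congr (_ _);
  exact: wo_le_anti.
have [[x Px]|nP] := pselect (exists x, inl x \in P).
  have [y Py miny] := wo_min (ex_intro (fun x => inl x \in P) x Px).
  by exists (inl y); split=> // -[z|//] /miny.
have [|y Py miny] := @wo_min B (fun y => inr y \in P).
  by case: u Pu => [x Px|y Py]; [case: nP; exists x | exists y].
by exists (inr y); split=> // -[z Pz|z /miny //]; case: nP; exists z.
Qed.

Definition wo_sum A B := WOSet (@sum_le_subproof A B).

Definition wo_iso (A B : woset) : Prop :=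
  exists2 f : A -> B, bijective f & {mono f : x y / wo_le x y}.

(* Isomorphisms onto an initial segment. *)
Definition is_wo_emb (A B : woset) (f : A -> B) : Prop :=
  {mono f : x y / wo_le x y} /\ forall x z, wo_le z (f x) -> exists y, f y = z.

Definition wo_emb (A B : woset) : Prop := exists f : A -> B, is_wo_emb f.

Section Embeddings.
Implicit Types A B C : woset.

Lemma is_wo_emb_inj A B (f : A -> B) : is_wo_emb f -> injective f.
Proof.
move=> [f_mono _] x y fxy.
by apply: wo_le_anti; rewrite -f_mono fxy wo_le_refl.
Qed.

Lemma is_wo_emb_uniq A B (f g : A -> B) : is_wo_emb f -> is_wo_emb g -> f =1 g.
Proof.
suff fg_le (f' g' : A -> B) : is_wo_emb f' -> is_wo_emb g' ->
    forall x, (forall y, wo_lt y x -> f' y = g' y) -> wo_le (g' x) (f' x).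
  move=> ef eg x; elim: x / (wo_lt_wf x) => x _ IH.
  by apply: wo_le_anti; apply: fg_le => // y yx; rewrite (IH y yx).
move=> ef eg x IH; apply: contrapT => /negP lt_fg.
have [y gy] := (proj2 eg) x (f' x) (wo_ltW lt_fg).
have yx : wo_lt y x by move: lt_fg; rewrite /wo_lt -gy (proj1 eg).
by move: (yx); rewrite -(is_wo_emb_inj ef (etrans (IH y yx) gy)) /wo_lt wo_le_refl.
Qed.

Lemma is_wo_emb_id A : is_wo_emb (@id A).
Proof. by split=> // x z _; exists z. Qed.

Lemma is_wo_emb_comp A B C (f : A -> B) (g : B -> C) :
  is_wo_emb f -> is_wo_emb g -> is_wo_emb (g \o f).
Proof.
move=> [fm fi] [gm gi]; split=> [x y|x z] /=; first by rewrite gm fm.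
move=> zgf; have [y gy] := gi _ _ zgf; move: zgf.
by rewrite -gy gm => /fi [w fw]; exists w; rewrite fw.
Qed.

Lemma wo_emb_refl A : wo_emb A A.
Proof. by exists id; exact: is_wo_emb_id. Qed.

Lemma wo_emb_trans B A C : wo_emb A B -> wo_emb B C -> wo_emb A C.
Proof. by move=> [f ef] [g eg]; exists (g \o f); exact: is_wo_emb_comp. Qed.

Lemma wo_isoP A B : wo_iso A B <-> wo_emb A B /\ wo_emb B A.
Proof.
split=> [[f [g fK gK] f_mono]|[[f ef] [g eg]]].
  split; first by exists f; split=> // x z _; exists (g z).
  exists g; split=> [x y|x z _]; first by rewrite -f_mono !gK.
  by exists (f z).
exists f; last exact: (proj1 ef).
exists g => x.
  exact: (is_wo_emb_uniq (is_wo_emb_comp ef eg) (is_wo_emb_id A)).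
exact: (is_wo_emb_uniq (is_wo_emb_comp eg ef) (is_wo_emb_id B)).
Qed.

Lemma wo_iso_refl A : wo_iso A A.
Proof. by apply/wo_isoP; split; exact: wo_emb_refl. Qed.

Lemma wo_iso_sym A B : wo_iso A B -> wo_iso B A.
Proof. by move/wo_isoP => [? ?]; apply/wo_isoP. Qed.

Lemma wo_iso_trans B A C : wo_iso A B -> wo_iso B C -> wo_iso A C.
Proof.
move=> /wo_isoP[AB BA] /wo_isoP[BC CB]; apply/wo_isoP.
by split; [exact: wo_emb_trans AB BC | exact: wo_emb_trans CB BA].
Qed.

Lemma wo_emb_total A B : wo_emb A B \/ wo_emb B A.
Proof.
pose free (x : A) (h : forall y, wo_lt y x -> option B) (z : B) :=
  forall y (yx : wo_lt y x), h y yx <> Some z.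
pose next (x : A) (h : forall y, wo_lt y x -> option B) : option B :=
  if pselect (exists z, free x h z) is left zP
  then Some (s2val (cid2 (wo_min zP))) else None.
pose f := Fix (@wo_lt_wf A) (fun=> option B) next.
have fE x : f x = next x (fun y _ => f y).
  rewrite /f Fix_eq // => {}x h k hk; congr next.
  by apply: functional_extensionality_dep => y; apply: funext.
have f_some x z : f x = Some z ->
    (forall y, wo_lt y x -> f y <> Some z) /\
    (forall w, wo_lt w z -> exists2 y, wo_lt y x & f y = Some w).
  rewrite fE /next; case: pselect => // zP [<-].
  case: cid2 => /= {}z z_free minz; split=> // w wz.
  apply: contrapT => nw; move: wz; rewrite /wo_lt minz // => y yx fy.
  by apply: nw; exists y.
have f_none x z : f x = None -> exists2 y, wo_lt y x & f y = Some z.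
  rewrite fE /next; case: pselect => // nz _; apply: contrapT => nw.
  by apply: nz; exists z => y yx fy; apply: nw; exists y.
have f_lt x y z w : f x = Some z -> f y = Some w -> wo_lt x y -> wo_lt z w.
  move=> fx fy xy; have [ny _] := f_some _ _ fy; apply/negP => wz.
  have [_ /(_ w) wx] := f_some _ _ fx.
  have [zw|/wx [v vx fv]] := boolP (wo_le z w).
    by apply: (ny x xy); rewrite fx (wo_le_anti zw wz).
  by apply: (ny v) fv; exact: wo_lt_le_trans vx (wo_ltW xy).
have f_mono x y z w : f x = Some z -> f y = Some w -> wo_le z w = wo_le x y.
  move=> fx fy; apply/idP/idP => [zw|xy].
    by apply: contrapT => /negP yx; have := f_lt _ _ _ _ fy fx yx; rewrite /wo_lt zw.
  apply: contrapT => /negP wz; have [yx|xy'] := boolP (wo_le y x).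
    by move: fy wz; rewrite -(wo_le_anti xy yx) fx => -[->]; rewrite wo_le_refl.
  by have := f_lt _ _ _ _ fx fy xy'; rewrite /wo_lt (wo_ltW wz).
have [[x fx]|f_all] := pselect (exists x, f x = None).
  right; have /choice[g fg] z : exists y, f y = Some z.
    by have [y _ fy] := f_none _ z fx; exists y.
  have [y ny miny] := wo_min (ex_intro (fun x => f x = None) x fx).
  exists g; split=> [z w|z u ug]; first exact/esym/f_mono.
  have [w fu] : exists w, f u = Some w.
    case fu: (f u) => [w|]; first by exists w.
    have [v vu fv] := f_none _ z fu.
    suff vg : v = g z by move: vu; rewrite vg /wo_lt ug.
    by apply: wo_le_anti; rewrite -(f_mono _ _ _ _ fv (fg z), f_mono _ _ _ _ (fg z) fv) wo_le_refl.
  by exists w; apply: wo_le_anti;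
    rewrite -?(f_mono _ _ _ _ (fg w) fu) -?(f_mono _ _ _ _ fu (fg w)) wo_le_refl.
left; have /choice[g fg] x : exists z, f x = Some z.
  by case fx: (f x) => [z|]; [exists z | case: f_all; exists x].
exists g; split=> [x y|x z zg]; first exact: f_mono.
have [zx|xz] := boolP (wo_le (g x) z).
  by exists x; apply: wo_le_anti.
have [y _ fy] := (proj2 (f_some _ _ (fg x))) z xz.
by exists y; move: fy; rewrite fg => -[].
Qed.

End Embeddings.

Lemma wo_iso_equiv : equiv_class_of (fun A B => `[< wo_iso A B >]).
Proof.
split=> [A|A B|B A C].
- exact/asboolP/wo_iso_refl.
- by apply/asboolP/asboolP; exact: wo_iso_sym.
- by move=> /asboolP AB /asboolP BC; apply/asboolP; exact: wo_iso_trans AB BC.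
Qed.

Canonical wo_iso_equiv_rel := EquivRelPack wo_iso_equiv.

Definition Ord := {eq_quot wo_iso_equiv_rel}.
HB.instance Definition _ := Choice.on Ord.
HB.instance Definition _ := EqQuotient.on Ord.

Definition otype (A : woset) : Ord := \pi_Ord A.

Definition ole (a b : Ord) : bool := `[< wo_emb (repr a) (repr b) >].

Lemma ole_refl : reflexive ole.
Proof. by move=> a; apply/asboolP; exact: wo_emb_refl. Qed.

Lemma ole_anti : antisymmetric ole.
Proof.
move=> a b /andP[/asboolP ab /asboolP ba].
rewrite -[a]reprK -[b]reprK; apply/eqmodP/asboolP/wo_isoP; split=> //.
Qed.

Lemma ole_trans : transitive ole.
Proof.
move=> b a c /asboolP ab /asboolP bc; apply/asboolP.
exact: wo_emb_trans ab bc.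
Qed.

Lemma ole_total : total ole.
Proof.
by move=> a b; have [ab|ba] := wo_emb_total (repr a) (repr b);
  apply/orP; [left|right]; apply/asboolP.
Qed.

Fact ord_display : Order.disp_t. Proof. exact: Order.Disp tt tt. Qed.

HB.instance Definition _ :=
  Order.Le_isPOrder.Build ord_display Ord ole_refl ole_anti ole_trans.
HB.instance Definition _ := Order.POrder_isTotal.Build ord_display Ord ole_total.

Lemma otypeP A B : otype A = otype B <-> wo_iso A B.
Proof. by split=> [/eqmodP/asboolP//|?]; apply/eqmodP/asboolP. Qed.

Lemma repr_otype A : wo_iso (repr (otype A)) A.
Proof. by apply/otypeP; exact: reprK. Qed.

Lemma otype_le A B : otype A <= otype B <-> wo_emb A B.
Proof.
have /wo_isoP[A1 A2] := repr_otype A; have /wo_isoP[B1 B2] := repr_otype B.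
split=> [/asboolP AB|AB]; last apply/asboolP.
  exact: wo_emb_trans (wo_emb_trans A2 AB) B1.
exact: wo_emb_trans (wo_emb_trans A1 AB) B2.
Qed.

Lemma otype_seg_le (A : woset) (x y : A) :
  (otype (wo_seg x) <= otype (wo_seg y)) = wo_le x y.
Proof.
have seg_emb (v w : A) : wo_le v w -> wo_emb (wo_seg v) (wo_seg w).
  move=> vw; exists (fun u => exist _ (proj1_sig u)
    (wo_lt_le_trans (proj2_sig u) vw)); split=> // u [z zw] /= zu.
  have zv : wo_lt z v by apply: contra (proj2_sig u) => /wo_le_trans; exact.
  by exists (exist _ z zv); exact: sval_inj_subproof.
apply/idP/idP => [/otype_le [f ef]|xy]; last exact/otype_le/seg_emb.
apply: contrapT => /negP yx.
have [g eg] := seg_emb _ _ (wo_ltW yx).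
pose u : wo_seg x := exist _ y yx.
have gf := is_wo_emb_comp ef eg.
have gi : is_wo_emb (fun v : wo_seg y => exist (fun z => wo_lt z x) (proj1_sig v)
    (wo_lt_le_trans (proj2_sig v) (wo_ltW yx)) : wo_seg x).
  split=> // -[v vy] [z zx] /= zv.
  have zy : wo_lt z y by apply: contra vy => /wo_le_trans; exact.
  by exists (exist _ z zy); exact: sval_inj_subproof.
have := is_wo_emb_uniq gf (is_wo_emb_id _) u => /=; rewrite (is_wo_emb_uniq eg gi).
by move=> /(congr1 (@proj1_sig _ _)) /= fu; have := proj2_sig (f u); rewrite /= fu /wo_lt wo_le_refl.
Qed.

Lemma lt_otypeP (A : woset) (b : Ord) :
  b < otype A <-> exists x : A, b = otype (wo_seg x).
Proof.
split=> [|[x ->]]; last first.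
  rewrite ltNge; apply/negP => /otype_le [f ef].
  have gi : is_wo_emb (fun v : wo_seg x => proj1_sig v).
    split=> // -[v vx] z /= zv.
    have zx : wo_lt z x by apply: contra vx => /wo_le_trans; exact.
    by exists (exist _ z zx).
  have gf := is_wo_emb_comp ef gi.
  have /= fx := is_wo_emb_uniq gf (is_wo_emb_id A) x.
  by have := proj2_sig (f x); rewrite fx /wo_lt wo_le_refl.
rewrite -[b]reprK -/(otype _) => bA.
have /otype_le [f ef] := ltW bA.
have [x nx] : exists x, ~ exists y, f y = x.
  apply: contrapT => nx; move: bA; rewrite ltNge => /negP; apply.
  have /choice [g fg] x : exists y, f y = x.
    by apply: contrapT => ny; apply: nx; exists x.
  apply/otype_le; exists g; split=> [x y|x z _].
    by rewrite -(proj1 ef) !fg.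
  by exists (f z); apply: (is_wo_emb_inj ef).
have {x nx} [x nx minx] := wo_min (ex_intro (fun x => ~ exists y, f y = x) x nx).
exists x; apply/otypeP/wo_isoP.
have fx y : wo_lt (f y) x.
  by apply/negP => xf; apply: nx; exact: (proj2 ef) xf.
split.
  exists (fun y => exist _ (f y) (fx y)); split=> [y z|y [z zx] zy].
    exact: (proj1 ef).
  have [w fw] := (proj2 ef) y z zy; exists w.
  exact: sval_inj_subproof.
have /choice [g fg] (u : wo_seg x) : exists y, f y = proj1_sig u.
  apply: contrapT => nu; have := proj2_sig u.
  by rewrite /= /wo_lt minx.
exists g; split=> [u v|u z _]; first by rewrite -(proj1 ef) !fg.
by exists (exist _ (f z) (fx z)); apply: (is_wo_emb_inj ef); rewrite fg.
Qed.

Lemma lt_reprP (a b : Ord) :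
  b < a <-> exists x : repr a, b = otype (wo_seg x).
Proof. by rewrite -{1}[a]reprK; exact: lt_otypeP. Qed.

Lemma Ord_min (P : set Ord) : P !=set0 -> exists2 a, P a & lbound P a.
Proof.
move=> [a Pa]; have [|na] := pselect (lbound P a); first by exists a.
have [x Px minx] : exists2 x : repr a, P (otype (wo_seg x)) &
    forall y, P (otype (wo_seg y)) -> wo_le x y.
  apply: wo_min; apply: contrapT => nx; apply: na => b Pb.
  rewrite leNgt; apply/negP => /lt_reprP [x bx].
  by apply: nx; exists x; rewrite -bx.
exists (otype (wo_seg x)) => // b Pb; rewrite leNgt; apply/negP => bx.
have : b < a by apply: lt_trans bx _; apply/lt_reprP; exists x.
move=> /lt_reprP [y yb]; move: bx; rewrite yb ltNge.
by rewrite otype_seg_le minx // -yb.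
Qed.

Lemma nat_le_subproof : well_order leq.
Proof.
apply: antisymmetric_well_order => [|P [n Pn]]; first exact: anti_leq.
have [m Pm minm] := ex_minnP (ex_intro (fun n => n \in P) n Pn).
by exists m.
Qed.

Definition wo_nat := WOSet nat_le_subproof.

Definition omega : Ord := otype wo_nat.
Definition ofin (n : nat) : Ord := otype (@wo_seg wo_nat n).

(* The default value is reached only for the empty set, see [oleastP]. *)
Definition oleast (P : set Ord) : Ord := xget (ofin 0) (P `&` lbound P).

Lemma oleastP (P : set Ord) : P !=set0 -> P (oleast P) /\ lbound P (oleast P).
Proof. by move=> /Ord_min [a Pa la]; exact: (@xgetI _ _ (P `&` lbound P) a). Qed.

(* The order on [wo_sum A B] puts A before B. *)
Definition oadd (a b : Ord) : Ord := otype (wo_sum (repr a) (repr b)).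

(* [osub b a] is b - a, characterized by [osubP] when a <= b. *)
Definition osub (b a : Ord) : Ord := xget (ofin 0) [set x | oadd a x = b].

Lemma oadd_otype A B : oadd (otype A) (otype B) = otype (wo_sum A B).
Proof.
apply/otypeP; have [f [f' fK f'K] fm] := repr_otype A.
have [g [g' gK g'K] gm] := repr_otype B.
exists (fun u => match u with inl x => inl (f x) | inr y => inr (g y) end).
  by exists (fun u => match u with inl x => inl (f' x) | inr y => inr (g' y) end);
    case=> x; rewrite ?(fK, gK, f'K, g'K).
by case=> x [] y //=; rewrite /= ?fm ?gm.
Qed.

Lemma oaddP (a b : Ord) : a <= b -> exists x, oadd a x = b.
Proof.
rewrite -[a]reprK -[b]reprK => /otype_le [f ef].
pose D (y : repr b) := `[< ~ exists x, f x = y >].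
exists (otype (wo_preim (@sval_inj_subproof _ D))).
rewrite [LHS]oadd_otype; apply/otypeP.
pose h (u : repr a + {y | D y}) := match u with inl x => f x | inr y => proj1_sig y end.
have hD x (y : {y | D y}) : wo_lt (f x) (proj1_sig y).
  apply/negP => yx; have /asboolP := proj2_sig y; apply.
  exact: (proj2 ef) yx.
have hm : {mono h : u v / @wo_le (wo_sum _ (wo_preim (@sval_inj_subproof _ D))) u v >-> wo_le u v}.
  move=> [x|x] [y|y] //=; first exact: (proj1 ef).
    by rewrite wo_ltW.
  by have := hD y x; rewrite /wo_lt => /negPf.
have /choice [k hk] y : exists u, h u = y.
  have [[x fx]|nx] := pselect (exists x, f x = y); first by exists (inl x).
  by have Dy : D y; [apply/asboolP | exists (inr (exist _ y Dy))].
exists h => //; exists k => // u.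
by apply: (@wo_le_anti (wo_sum _ (wo_preim (@sval_inj_subproof _ D)))); rewrite -hm hk wo_le_refl.
Qed.

Lemma oaddI (a : Ord) : injective (oadd a).
Proof.
suff emb (A B C : woset) : wo_emb (wo_sum A B) (wo_sum A C) -> wo_emb B C.
  move=> x y; rewrite -[x]reprK -[y]reprK -[a]reprK ![oadd _ _]oadd_otype.
  move=> /otypeP/wo_isoP [xy yx].
  by apply/otypeP/wo_isoP; split; exact: emb xy || exact: emb yx.
move=> [f ef].
have [BC|[g eg]] := wo_emb_total B C => //.
pose h (u : wo_sum A C) : wo_sum A B :=
  match u with inl x => inl x | inr y => inr (g y) end.
have eh : is_wo_emb h.
  split=> [[x|x] [y|y]|[x|x] [y|y]] //=; first exact: (proj1 eg).
  - by exists (inl y).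
  - by exists (inl y).
  - by move=> /(proj2 eg) [z gz]; exists (inr z); rewrite /= gz.
have /choice [k gk] y : exists z, g z = y.
  have := is_wo_emb_uniq (is_wo_emb_comp ef eh) (is_wo_emb_id _) (inr y) => /=.
  by case: (f _) => //= z [<-]; exists z.
exists k; split=> [x y|x z _]; first by rewrite -(proj1 eg) !gk.
by exists (g z); exact: (is_wo_emb_inj eg).
Qed.

Lemma osubP (a b x : Ord) : a <= b -> osub b a = x <-> oadd a x = b.
Proof.
move=> /oaddP [y yb].
have -> : osub b a = y.
  by apply: xget_unique => //= z zb; apply: (@oaddI a); rewrite yb.
by split=> [<-//|]; rewrite -yb => /oaddI ->.
Qed.

Definition below (a : Ord) : set Ord := [set x | x < a].

(* Cardinals are initial ordinals; the successor always exists by [csuccP]. *)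
Definition is_cardinal (a : Ord) : Prop :=
  forall b, b < a -> ~ (below a #<= below b).

Definition csucc (a : Ord) : Ord := oleast [set c | is_cardinal c /\ a < c].

Lemma Ord_wo : well_order ole.
Proof.
apply: antisymmetric_well_order => [|P [a Pa]]; first exact: ole_anti.
have [|b Pb lb] := @Ord_min [set a | a \in P]; first by exists a.
by exists b; split=> // c /lb.
Qed.

Lemma hartogs (K : woset) : exists H : woset, ~ exists i : H -> K, injective i.
Proof.
pose T := ((K -> bool) * (K -> K -> bool))%type.
pose le (p : T) : rel {x : K | p.1 x} := fun u v => p.2 (proj1_sig u) (proj1_sig v).
pose S : set Ord := [set a | exists p : T, exists wp : well_order (@le p), a = otype (WOSet wp)].
have S_down a b : S a -> b < a -> S b.
  move=> [p [wp ->]] /lt_otypeP [y ->].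
  pose D x := `[< exists xp : p.1 x, wo_lt (exist _ x xp : WOSet wp) y >].
  pose f (u : wo_seg y) : {x | D x} := exist _ (proj1_sig (proj1_sig u))
    (asboolT (ex_intro (fun xp => wo_lt (exist _ _ xp : WOSet wp) y)
      (proj2_sig (proj1_sig u))
      (eq_ind _ (fun z : WOSet wp => wo_lt z y) (proj2_sig u) _
        (sval_inj_subproof (erefl : proj1_sig (proj1_sig u) =
           proj1_sig (exist (fun x => p.1 x) _ (proj2_sig (proj1_sig u)))))))).
  have finj : injective f.
    by move=> u v /(congr1 (@proj1_sig _ _)) /= /sval_inj_subproof /sval_inj_subproof.
  have fsurj z : exists u, f u = z.
    case: z => x Dx; have /asboolP [xp xy] := Dx.
    by exists (exist (fun z : WOSet wp => wo_lt z y) (exist _ x xp) xy); exact: sval_inj_subproof.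
  have /choice [g fg] := fsurj.
  have gf : cancel f g by move=> u; apply: finj; rewrite fg.
  have wq : well_order (@le (D, p.2)).
    have := @wo_preim_subproof _ (wo_seg y) g (can_inj fg).
    congr (well_order _); apply: funext => u; apply: funext => v /=.
    by rewrite -{2}[u]fg -{2}[v]fg.
  exists (D, p.2), wq; apply/otypeP; exists f => //.
  by exists g.
have otype_irr p q (wp : well_order (@le p)) (wq : well_order (@le q)) :
    p = q -> otype (WOSet wp) = otype (WOSet wq).
  by move=> pq; case: _ / pq in wq *; rewrite (Prop_irrelevance wp wq).
have /choice [rep repP] a : exists p : T, S a ->
    exists wp : well_order (@le p), a = otype (WOSet wp).
  have [[p Sp]|nS] := pselect (S a); first by exists p => _.
  by exists (fun=> true, fun _ _ => true).
pose G (p : T) := `[< exists2 a, S a & rep a = p >].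
have /choice [phi phiP] (u : {p | G p}) : exists a, S a /\ rep a = proj1_sig u.
  by have /asboolP [a Sa au] := proj2_sig u; exists a.
have phi_inj : injective phi.
  by move=> u v uv; apply: sval_inj_subproof; rewrite -(phiP u).2 -(phiP v).2 uv.
have phi_surj a : S a -> exists u, phi u = a.
  move=> Sa; have Ga : G (rep a) by apply/asboolP; exists a.
  exists (exist (fun p => G p) _ Ga); have [Sb rb] := phiP (exist (fun p => G p) _ Ga).
  have [wp ep] := repP _ Sb; have [wq eq] := repP _ Sa.
  by apply: (etrans ep); apply: (etrans _ (esym eq)); exact: otype_irr rb.
have wH : well_order (relpre phi ole).
  move=> P [t0 Pt0].
  have [|_ [t Pt <-] mint] := @Ord_min [set a | exists2 t, t \in P & phi t = a].
    by exists (phi t0), t0.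
  have lt t' : t' \in P -> phi t <= phi t' by move=> ?; apply: mint; exists t'.
  exists t; split=> [|t' [Pt' mint']]; first by split.
  by apply: phi_inj; apply: ole_anti; apply/andP; split; [exact: lt | exact: mint'].
pose H := WOSet wH; exists H => -[i i_inj].
have phi_lt (v : H) : phi v < otype H.
  apply: (@le_lt_trans _ _ (otype (wo_seg v))); last by apply/lt_otypeP; exists v.
  rewrite -[phi v]reprK; apply/otype_le.
  have /choice [f fP] (x : repr (phi v)) : exists w : wo_seg v,
      phi (proj1_sig w) = otype (wo_seg x).
    have lt : otype (wo_seg x) < phi v by apply/lt_reprP; exists x.
    have [w wx] := phi_surj _ (S_down _ _ (phiP v).1 lt).
    have wv : @wo_lt H w v by rewrite /wo_lt /= -[ole _ _]/(phi v <= phi w) wx -ltNge.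
    by exists (exist _ w wv).
  exists f; split=> [x y|x [z zv] zx].
    by rewrite -[LHS]/(phi (proj1_sig (f x)) <= phi (proj1_sig (f y))) !fP otype_seg_le.
  have : phi z < phi v by rewrite ltNge.
  move=> /lt_reprP [y zy]; exists y; apply: sval_inj_subproof => /=.
  by apply: phi_inj; rewrite fP.
suff [u0 Hu0] : exists u0, phi u0 = otype H by have := phi_lt u0; rewrite Hu0 ltxx.
apply: phi_surj; pose D x := `[< exists u, i u = x >].
have Di u : D (i u) by apply/asboolP; exists u.
have /choice [j ij] (x : {x | D x}) : exists u, i u = proj1_sig x.
  by have /asboolP [u ux] := proj2_sig x; exists u.
pose r x y := `[< exists u v : H, [/\ i u = x, i v = y & wo_le u v] >].
have rE (x y : {x | D x}) : r (proj1_sig x) (proj1_sig y) = wo_le (j x : H) (j y).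
  apply/asboolP/idP => [[u [v [ux vy uv]]]|xy]; last by exists (j x), (j y); rewrite !ij.
  have -> : j x = u by apply: i_inj; rewrite ij.
  by have -> : j y = v by apply: i_inj; rewrite ij.
have j_inj : injective j.
  by move=> x y xy; apply: sval_inj_subproof; rewrite -!ij xy.
have wq : well_order (@le (D, r)).
  have := @wo_preim_subproof _ H j j_inj.
  by congr (well_order _); apply: funext => u; apply: funext => v; exact/esym/rE.
exists (D, r), wq; apply/esym/otypeP; exists (j : WOSet wq -> H).
  by exists (fun u => exist _ (i u) (Di u)) => u;
    [apply: sval_inj_subproof | apply: i_inj]; rewrite /= ij.
by move=> x y; exact/esym/rE.
Qed.

Lemma below_card_le (A B : woset) :
  (below (otype A) #<= below (otype B)) <-> exists f : A -> B, injective f.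
Proof.
have b_inj (C : woset) : exists f : C -> below (otype C), injective f.
  have Cb (x : C) : otype (wo_seg x) \in below (otype C).
    by rewrite inE; apply/lt_otypeP; exists x.
  exists (fun x => SigSub (Cb x)) => x y /(congr1 val) /= xy.
  by apply: wo_le_anti; rewrite -otype_seg_le xy.
have b_surj (C : woset) : exists f : below (otype C) -> C, injective f.
  have /choice [f fP] (u : below (otype C)) :
      exists x : C, val u = otype (wo_seg x).
    by apply/lt_otypeP; have := valP u; rewrite inE.
  by exists f => u v uv; apply: val_inj; rewrite !fP uv.
have [[f fi] [g gi]] := (b_inj A, b_surj A).
have [[h hi] [k ki]] := (b_inj B, b_surj B).
split=> [/card_leP /injfunPex [i _ ii]|[i ii]].
  exists (k \o i \o f) => x y /ki /ii fxy.
  by apply: fi; apply: fxy; rewrite inE.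
apply/card_leP/injfunPex; exists (h \o i \o g) => // x y _ _ /hi /ii; exact: gi.
Qed.

Lemma csuccP (a : Ord) :
  [/\ is_cardinal (csucc a), a < csucc a &
      forall c, is_cardinal c -> a < c -> csucc a <= c].
Proof.
suff [c cP] : exists c, is_cardinal c /\ a < c.
  have [|[? ?] lb] := @oleastP [set c | is_cardinal c /\ a < c]; first by exists c.
  by split=> // d dP ad; apply: lb.
have [H nH] := hartogs (repr a).
have [|c nc minc] := @Ord_min [set c | ~ (below c #<= below a)].
  by exists (otype H) => /=; rewrite -[a]reprK; move=> /below_card_le.
have ac : a < c.
  rewrite ltNge; apply/negP => ca; apply: nc; apply: subset_card_le => x /=.
  by move=> xc; exact: lt_le_trans xc ca.
exists c; split=> // b bc cb.
have [ba|nba] := boolP (below b #<= below a).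
  by apply: nc; exact: card_le_trans cb ba.
by have := minc b (negP nba); rewrite leNgt bc.
Qed.

Lemma lt_csucc (a b : Ord) : b < csucc a <-> below b #<= below a.
Proof.
have [ccard ac least] := csuccP a.
split=> [|ba]; last first.
  by rewrite ltNge; apply/negP => cb; apply: (ccard a ac); apply: card_le_trans _ ba;
    apply: subset_card_le => x /= xc; exact: lt_le_trans xc cb.
apply: contraPT => /negP nba.
have [|c nc minc] := @Ord_min [set c | ~ (below c #<= below a)]; first by exists b.
apply/negP; rewrite -leNgt (le_trans (least c _ _)) ?minc //.
  move=> d dc cd; have [da|nda] := boolP (below d #<= below a).
    by apply: nc; exact: card_le_trans cd da.
  by have := minc d (negP nda); rewrite leNgt dc.
rewrite ltNge; apply/negP => ca; apply: nc; apply: subset_card_le => x /=.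
by move=> xc; exact: lt_le_trans xc ca.
Qed.

(* aleph_n, that is, omega_n as an initial ordinal. *)
Definition aleph (n : nat) : Ord := iter n csucc omega.

Definition card_lt T U (A : set T) (B : set U) : Prop :=
  A #<= B /\ ~ (B #<= A).

Definition osucc (a : Ord) : Ord := oadd a (ofin 1).

Definition is_limit (a : Ord) : Prop :=
  a <> ofin 0 /\ forall b, a <> osucc b.

Definition tau (a b x : Ord) : Ord := if x < a then x else oadd b (osub x a).

Definition order_embedding (a b : Ord) (f : below a -> below b) : Prop :=
  forall x y, (val (f x) <= val (f y)) = (val x <= val y).

(* An ordinal a is identified with the set [below a], so a map from theta a
   into theta b is a function between the corresponding types. The values of
   theta beyond kappa, and those of F outside a < b <= kappa, are irrelevant. *)
Record simplified_morass (kappa : Ord) (theta : Ord -> Ord)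
    (F : forall a b, set (below (theta a) -> below (theta b))) : Prop := {
  morass_kappa : is_cardinal kappa /\ omega <= kappa ;
  morass_P0a : [/\ theta (ofin 0) = ofin 2,
      forall a, a < kappa -> ofin 0 < theta a < kappa
    & theta kappa = csucc kappa] ;
  morass_P0b : forall a b, a < b -> b <= kappa ->
    F a b `<=` @order_embedding (theta a) (theta b) ;
  morass_P1 : forall a b, a < b -> b < kappa -> card_lt (F a b) (below kappa) ;
  morass_P2 : forall a b c, a < b -> b < c -> c <= kappa ->
    F a c = [set f \o g | f in F b c & g in F a b] ;
  morass_P3 : forall a, a < kappa -> exists d,
    [/\ ofin 0 < d < theta a,
        theta (osucc a) = oadd (theta a) (osub (theta a) d)
      & F a (osucc a) = [set f | (forall x, val (f x) = val x) \/
          (forall x, val (f x) = tau d (theta a) (val x))]] ;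
  morass_P4 : forall l, is_limit l -> l <= kappa ->
    forall a0 a1 f0 f1, a0 < l -> a1 < l -> F a0 l f0 -> F a1 l f1 ->
    exists a, [/\ a < l, a0 < a, a1 < a & exists f0' f1' g,
      [/\ F a0 a f0', F a1 a f1', F a l g, f0 = g \o f0' & f1 = g \o f1']] ;
  morass_P5 : forall a, ofin 0 < a -> a <= kappa ->
    [set: below (theta a)] = \bigcup_(x in below a) \bigcup_(f in F x a) range f }.

Arguments simplified_morass kappa theta F : clear implicits.

Section Ladders.
Context {d : Order.disp_t}.

Definition lower_finite (P : porderType d) : Prop :=
  forall p : P, finite_set [set x | x <= p].

Definition lower_cover (P : porderType d) (x y : P) : Prop :=
  x < y /\ ~ exists z, x < z < y.

Definition is_ladder (k : nat) (L : bLatticeType d) : Prop :=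
  lower_finite L /\ forall y : L, [set x | lower_cover x y] #<= `I_k.

Definition is_atom (L : bLatticeType d) (a : L) : Prop := lower_cover \bot a.

Definition atomistic (L : bLatticeType d) : Prop :=
  forall x : L, exists2 A : set L, A `<=` @is_atom L & supremums A x.

End Ladders.

(* Main.v *)
(* By recursion along the morass one builds a countable atomistic 3-ladder P_a for
   each a < omega_1, with a grading P_a -> theta_a such that gr (x \/ y) is the
   maximum of gr x and gr y, in such a way that every morass map theta_a -> theta_b
   induces an embedding of P_a onto an ideal of P_b. At a limit, P_l is the directed
   union of the images of the previous P_a. At a successor, P_(a+1) contains P_a and
   its shifted copy P_a', which share the ideal of the elements of grade below
   delta_a. Fix finite ideals A_0, A_1, ... increasing to P_a. The missing joins are
   provided by new elements (n, xi), one for each n and each grade xi occurring in A_n'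
   outside the common part; below (n, xi) lie A_n, the elements of A_n' of grade at
   most xi, and the (m, eta) with m <= n and eta <= xi. What is strictly below (n, xi)
   is the union of three directed sets, so there are at most three lower covers.
   The ladder is P_(omega_1); its grading is onto theta_(omega_1) = omega_2. *)

Require Import Defs.
From HB Require Import structures.
From mathcomp Require Import all_boot all_order.
From mathcomp Require Import boolp classical_sets functions cardinality.

Set Implicit Arguments.
Unset Strict Implicit.
Unset Printing Implicit Defensive.

Import Order.TTheory.
Local Open Scope classical_set_scope.
Local Open Scope card_scope.
Local Open Scope order_scope.

(** * Ordinals and cardinals *)

Lemma Ord_lt_wf : well_founded (fun a b : Ord => a < b).
Proof.
move=> a; apply: contrapT => na.
have [b nb minb] := @Ord_min [set b : Ord | ~ Acc (fun x y : Ord => x < y) b]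
  (ex_intro _ a na).
apply: nb; constructor=> c cb; apply: contrapT => /minb.
by rewrite leNgt cb.
Qed.

Lemma Ord_ind (P : Ord -> Prop) : (forall b, (forall a, a < b -> P a) -> P b) -> forall b, P b.
Proof. by move=> IH b; elim: b / (Ord_lt_wf b) => b _; exact: IH. Qed.

Lemma ofin0_le (a : Ord) : ofin 0 <= a.
Proof.
rewrite -[a]reprK; apply/otype_le.
have no (u : @wo_seg wo_nat 0) : False by case: u.
by exists (fun u => False_rect _ (no u)); split=> u; case: (no u).
Qed.

Lemma oadd0 (a : Ord) : oadd a (ofin 0) = a.
Proof.
rewrite -[in LHS](reprK a) oadd_otype -[RHS]reprK; apply/otypeP.
have no (u : @wo_seg wo_nat 0) : False by case: u.
exists (fun u => match u with inl x => x | inr y => False_rect _ (no y) end).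
  by exists inl => // -[|y] //; case: (no y).
by move=> [x|y] [z|t] //; case: (no y) || case: (no t).
Qed.

Lemma le_oadd2l (a b c : Ord) : b <= c -> oadd a b <= oadd a c.
Proof.
move=> /asboolP [f [fm fi]]; apply/otype_le.
exists (fun u => match u with inl x => inl x | inr y => inr (f y) end).
by split=> [[x|x] [y|y]|[x|x] [y|y]] //= => [_|_|/fi [z <-]];
  [exists (inl y)|exists (inl y)|exists (inr z)].
Qed.

Lemma lt_oadd2l (a b c : Ord) : b < c -> oadd a b < oadd a c.
Proof.
move=> bc; rewrite lt_neqAle le_oadd2l ?ltW // andbT.
by apply/eqP => /oaddI e; rewrite e ltxx in bc.
Qed.

Lemma le_oaddr (a b : Ord) : a <= oadd a b.
Proof. by rewrite -{1}[a]oadd0; apply/le_oadd2l/ofin0_le. Qed.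

Lemma lt_omega (a : Ord) : a < omega <-> exists n, a = ofin n.
Proof. exact: lt_otypeP. Qed.

Lemma ofin_lt m n : (ofin m < ofin n) = (m < n)%N.
Proof. by rewrite !ltNge /ofin otype_seg_le -ltnNge. Qed.

Lemma lt_ofin (a : Ord) n : a < ofin n <-> exists2 m, (m < n)%N & a = ofin m.
Proof.
split=> [an|[m mn ->]]; last by rewrite ofin_lt.
have /lt_omega [m am] : a < omega.
  by apply: lt_trans an _; apply/lt_omega; exists n.
by exists m => //; rewrite -ofin_lt -am.
Qed.

Lemma lt_osucc (a : Ord) : a < osucc a.
Proof.
rewrite lt_neqAle le_oaddr andbT; apply/eqP => aS.
have : oadd a (ofin 0) = oadd a (ofin 1) by rewrite oadd0.
by move=> /oaddI; apply/eqP; rewrite lt_eqF // ofin_lt.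
Qed.

Lemma lt_osuccE (a b : Ord) : (b < osucc a) = (b <= a).
Proof.
apply/idP/idP => [|ba]; last exact: le_lt_trans ba (lt_osucc a).
rewrite leNgt; apply: contraL => ab; rewrite -leNgt.
have [x xb] := oaddP (ltW ab); rewrite -xb; apply: le_oadd2l.
rewrite leNgt; apply/negP => /lt_ofin [[|] // _ x0].
by move: ab; rewrite -xb x0 oadd0 ltxx.
Qed.

Lemma osucc_inj : injective osucc.
Proof. by move=> a b e; apply: le_anti; rewrite -!lt_osuccE e lt_osucc -e lt_osucc. Qed.

Lemma le_osucc (a b : Ord) : (osucc a <= b) = (a < b).
Proof. by rewrite leNgt lt_osuccE -ltNge. Qed.

Lemma ord_cases (b : Ord) : [\/ b = ofin 0, exists a, b = osucc a | is_limit b].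
Proof.
have [->|b0] := pselect (b = ofin 0); first by constructor 1.
have [[a ->]|bs] := pselect (exists a, b = osucc a); first by constructor 2; exists a.
by constructor 3; split=> // a ba; apply: bs; exists a.
Qed.

Lemma limit_succ (l a : Ord) : is_limit l -> a < l -> osucc a < l.
Proof.
move=> [_ ns] al; rewrite lt_neqAle le_osucc al andbT.
by apply/eqP => e; apply: (ns a).
Qed.

Lemma limit_gt0 (l : Ord) : is_limit l -> ofin 0 < l.
Proof. by move=> [l0 _]; rewrite lt_neqAle ofin0_le andbT; apply/eqP => /esym. Qed.

Lemma countable_below (a : Ord) : a < aleph 1 -> countable (below a).
Proof.
move=> /lt_csucc ao; apply: card_le_trans ao _.
have -> : below omega = range ofin.
  by apply/seteqP; split=> [x /lt_omega [n ->]|x [n _ <-]]; [exists n | apply/lt_omega; exists n].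
exact: card_image_le.
Qed.

(** The meet of two elements is the join of their common lower bounds, which are finitely many by
    lower finiteness; [o] serves as the empty join. *)
Lemma lower_finite_lattice (T : choiceType) (r : rel T) (o : T) :
  reflexive r -> antisymmetric r -> transitive r -> (forall x, r o x) ->
  (forall x, finite_set [set y | r y x]) ->
  (forall x y, exists z, forall w, r z w = r x w && r y w) ->
  exists (d : Order.disp_t) (L : bLatticeType d) (f : T -> L),
    bijective f /\ forall x y, (f x <= f y) = r x y.
Proof.
case: T r o => T cT; pose C := Choice.Pack cT.
rewrite -/C => r o rr ra rt ro rfin rjoin.
have /choice [j jP] (p : C * C) : exists z, forall w, r z w = r p.1 w && r p.2 w.
  exact: rjoin.
have seq_join (s : seq C) : exists z, forall w, r z w = all (r^~ w) s.
  elim: s => [|x s [z zP]]; first by exists o => w; rewrite ro.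
  by exists (j (x, z)) => w; rewrite jP zP.
have /choice [m mP] (p : C * C) : exists z, forall w, r w z = r w p.1 && r w p.2.
  have /finite_seqP [s sE] : finite_set [set w | r w p.1 && r w p.2].
    by apply: sub_finite_set (rfin p.1) => w /= /andP[].
  have sP w : (w \in s) = r w p.1 && r w p.2.
    by apply/idP/idP => ws; [have : [set` s] w by [] | have : [set w | r w p.1 && r w p.2] w by []];
      rewrite ?sE // -sE.
  have [z zP] := seq_join s; exists z => w; apply/idP/andP => [wz|/andP].
    by split; apply: rt wz _; rewrite zP; apply/allP => u; rewrite sP => /andP[].
  by rewrite -sP => ws; have := zP z; rewrite rr => /esym /allP; apply.
pose d := Order.Disp tt tt.
pose Le := Order.Le_isPOrder.Build d (Choice.Pack cT) rr ra rt.
pose PO : porderType d := HB.pack T cT Le.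
pose ML := Order.POrder_MeetJoin_isLattice.Build d PO
  (fun x y z => mP (y, z) x) (fun x y z => jP (x, y) z).
pose LT : latticeType d := HB.pack PO ML.
pose Bo := Order.hasBottom.Build d LT ro.
pose L : bLatticeType d := HB.pack LT Bo.
by exists d, L, (id : C -> L); split=> //; exists id.
Qed.

Lemma card_le_inj (T U : Type) (A : set T) (B : set U) (f : T -> U) :
  (forall x, A x -> B (f x)) -> (forall x y, A x -> A y -> f x = f y -> x = y) ->
  A #<= B.
Proof.
move=> AB fi; have fA : {in A &, injective f}.
  by move=> x y; rewrite !inE => Ax Ay; exact: fi.
have := inj_card_eq fA; rewrite card_eq_le => /andP[_ le].
by apply: (card_le_trans le); apply: subset_card_le => _ [x Ax <-]; exact: AB.
Qed.

Lemma card_le_injP (T U : Type) (u : U) (A : set T) (B : set U) : A #<= B ->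
  exists2 f : T -> U, (forall x, A x -> B (f x)) &
    forall x y, A x -> A y -> f x = f y -> x = y.
Proof.
move=> /card_leP/injfunPex [f _ fi].
exists (fun x => if pselect (A x) is left Ax then val (f (SigSub (mem_set Ax : x \in A))) else u).
  by move=> x Ax; case: pselect => // Ax'; have := set_mem (valP (f (SigSub (mem_set Ax' : x \in A)))).
move=> x y Ax Ay; case: pselect => // Ax'; case: pselect => // Ay' /val_inj e.
by have /(congr1 val) := fi _ _ (mem_setT _) (mem_setT _) e.
Qed.

Lemma card_nat_omega : [set: nat] #<= below omega.
Proof.
apply: (card_le_inj (f := ofin)) => [n _|m n _ _ e]; first by apply/lt_omega; exists n.
by apply/eqP; rewrite eqn_leq leqNgt -ofin_lt e ltxx /= leqNgt -ofin_lt e ltxx.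
Qed.

Lemma lt_aleph1 (a : Ord) : a < aleph 1 <-> countable (below a).
Proof.
split; first exact: countable_below.
by move=> ca; apply/lt_csucc; exact: card_le_trans ca card_nat_omega.
Qed.

Lemma osucc_lt_aleph1 (a : Ord) : a < aleph 1 -> osucc a < aleph 1.
Proof.
move=> /lt_aleph1 ca; apply/lt_aleph1.
pose E (i : bool) := if i then [set a] else below a.
apply: (@sub_countable _ _ _ (\bigcup_i E i)).
  apply: subset_card_le => x; rewrite /below /= lt_osuccE le_eqVlt.
  by move=> /orP [/eqP ->|xa]; [exists true | exists false].
by apply: bigcup_countable => // -[] _ //; exact: countable1.
Qed.

(* Points are ranked by the least ordinal not yet taken, along the well-order
   comparing [g] first and then an injection of the part of [A] below the
   common value of [g]. *)
Lemma card_le_csucc (T : Type) (A : set T) (g : T -> Ord) (k : Ord) :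
  (forall y, A y -> A `&` [set x | g x <= g y] #<= below k) -> A #<= below (csucc k).
Proof.
move=> Ag; have /choice [h hP] (c : Ord) : exists h : T -> Ord,
    forall x y, A x -> A y -> g x = c -> g y = c -> h x = h y -> x = y.
  have [[z Az zc]|nz] := pselect (exists2 z, A z & g z = c); last first.
    by exists (fun=> ofin 0) => x y Ax _ xc; case: nz; exists x.
  have [h _ hinj] := card_le_injP (ofin 0) (Ag z Az).
  by exists h => x y Ax Ay xc yc; apply: hinj; split; rewrite //= zc ?xc ?yc.
pose prec x y := A x /\ (g x < g y \/ g x = g y /\ h (g x) x < h (g x) y).
have prec_wf : well_founded prec.
  suff Acc_prec c : forall i y, g y = c -> h c y = i -> Acc prec y.
    by move=> y; exact: (Acc_prec (g y) (h (g y) y)).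
  elim/Ord_ind: c => c IHc i; elim/Ord_ind: i => i IHi y gy hy.
  constructor=> x [_ [xy|[e xy]]]; first by apply: (IHc (g x)) => //; rewrite -gy.
  by apply: (IHi (h c x)) => //; rewrite -?hy -?gy -?e // e.
pose step y (r : forall x, prec x y -> Ord) :=
  oleast [set o | forall x (xy : prec x y), r x xy <> o].
pose rank := Fix prec_wf (fun=> Ord) step.
have rankE y : rank y = oleast [set o | forall x, prec x y -> rank x <> o].
  rewrite /rank Fix_eq // => {}y r r' rr'; congr oleast.
  by apply/seteqP; split=> o ro x xy; [rewrite -rr' | rewrite rr']; exact: ro.
(* Otherwise the ranks of the predecessors of [y] would exhaust [below (csucc k)], although these
   predecessors all lie in the part of [A] up to [g y], of cardinality at most [k]. *)
have unused y : A y -> exists2 o, o < csucc k & forall x, prec x y -> rank x <> o.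
  move=> Ay; apply: contrapT => no.
  suff /lt_csucc : below (csucc k) #<= below k by rewrite ltxx.
  apply: card_le_trans (Ag y Ay).
  apply: (card_le_trans _ (card_image_le rank _)); apply: subset_card_le => o ok.
  apply: contrapT => nx; apply: no; exists o => // x [Ax xy] xo; apply: nx.
  by exists x => //; split=> //=; case: xy => [/ltW|[->]].
have rankP y : A y -> rank y < csucc k /\ forall x, prec x y -> rank x <> rank y.
  move=> /unused [o ok oy].
  have [|ry lb] := @oleastP [set o | forall x, prec x y -> rank x <> o]; first by exists o.
  rewrite (rankE y); split=> //.
  by apply: le_lt_trans ok; exact: lb.
apply: (card_le_inj (f := rank)) => [y Ay|x y Ax Ay e]; first exact: (rankP y Ay).1.
case: (ltgtP (g x) (g y)) => gxy.
- by case: ((rankP y Ay).2 x) => //; split=> //; left.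
- by case: ((rankP x Ax).2 y) => //; split=> //; left.
- case: (ltgtP (h (g x) x) (h (g x) y)) => hxy.
  + by case: ((rankP y Ay).2 x) => //; split=> //; right.
  + by case: ((rankP x Ax).2 y) => //; split=> //; right; rewrite -gxy.
  + by apply: (hP (g x)) => //; rewrite gxy.
Qed.

(** * Morass maps *)

Section Morass.
Variables (theta : Ord -> Ord)
          (F : forall a b, set (below (theta a) -> below (theta b))).
Arguments F a b : clear implicits.
Hypothesis MF : simplified_morass (aleph 1) theta F.
Local Notation kappa := (aleph 1).

(* Morass maps, extended arbitrarily to all ordinals, with the identities of
   the [theta a] added. *)
Definition mmap (a b : Ord) : set (Ord -> Ord) := fun h =>
  (a = b /\ forall x, x < theta a -> h x = x) \/
  (a < b /\ exists2 f, F a b f & forall x : below (theta a), h (val x) = val (f x)).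

Lemma below_lt a (x : below a) : val x < a.
Proof. by have := set_mem (valP x). Qed.

Definition to_below a x (xa : x < a) : below a := SigSub (mem_set xa : x \in below a).

Definition total_ext a b (f : below (theta a) -> below (theta b)) (x : Ord) : Ord :=
  if pselect (x < theta a) is left xa then val (f (to_below xa)) else x.

Lemma total_extE a b (f : below (theta a) -> below (theta b)) x :
  total_ext f (val x) = val (f x).
Proof.
rewrite /total_ext; case: pselect => [xa|]; last by have := below_lt x.
by congr (val (f _)); apply: val_inj.
Qed.

Lemma mmap_le a b h : mmap a b h -> a <= b.
Proof. by case=> [[->]//|[/ltW]]. Qed.

Lemma mmap_id a : mmap a a id.
Proof. by left. Qed.

Lemma mmap_refl a h x : mmap a a h -> x < theta a -> h x = x.
Proof. by case=> [[_]|[]]; [exact | rewrite ltxx]. Qed.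

Lemma mmap_lt a b h x : mmap a b h -> x < theta a -> h x < theta b.
Proof.
case=> [[<-] hid xa|[ab [f _ hf]] xa]; first by rewrite hid.
by rewrite (hf (to_below xa)); exact: below_lt.
Qed.

Lemma mmap_mono a b h x y : b <= kappa -> mmap a b h -> x < theta a -> y < theta a ->
  (h x <= h y) = (x <= y).
Proof.
move=> bk [[_ hid] xa ya|[ab [f Ff hf]] xa ya]; first by rewrite !hid.
rewrite (hf (to_below xa)) (hf (to_below ya)).
exact: (morass_P0b MF ab bk Ff).
Qed.

Lemma mmap_mono_lt a b h x y : b <= kappa -> mmap a b h -> x < theta a -> y < theta a ->
  (h x < h y) = (x < y).
Proof. by move=> bk Gh xa ya; rewrite !ltNge (mmap_mono bk Gh). Qed.

Lemma mmap_inj a b h x y : b <= kappa -> mmap a b h -> x < theta a -> y < theta a ->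
  h x = h y -> x = y.
Proof.
by move=> bk Gh xa ya e; apply: le_anti;
  rewrite -(mmap_mono bk Gh xa ya) -(mmap_mono bk Gh ya xa) e lexx.
Qed.

Lemma mmap_comp a b c g h : c <= kappa -> mmap a b g -> mmap b c h -> mmap a c (h \o g).
Proof.
move=> ck [[<-] gid|[ab [f Ff gf]]].
  case=> [[<-] hid|[ac [f Ff hf]]].
    by left; split=> // x xa /=; rewrite gid // hid.
  by right; split=> //; exists f => // x /=; rewrite gid ?hf ?below_lt.
case=> [[<-] hid|[bc [f' Ff' hf]]].
  by right; split=> //; exists f => // x /=; rewrite gf hid // below_lt.
right; split; first exact: lt_trans bc.
exists (f' \o f); last by move=> x /=; rewrite gf hf.
by rewrite (morass_P2 MF ab bc ck); exists f' => //; exists f.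
Qed.

(** This is the inclusion of P2 that splits a map; the identities added to [mmap] absorb the cases
    [a = b] and [b = c]. *)
Lemma mmap_factor a b c h : a <= b -> b <= c -> c <= kappa -> mmap a c h ->
  exists g k, [/\ mmap a b g, mmap b c k & forall x, x < theta a -> h x = k (g x)].
Proof.
move=> ab bc ck Gh; have [eab|nab] := eqVneq a b.
  by case: _ / eab in bc *; exists id, h; split=> //; exact: mmap_id.
have [ebc|nbc] := eqVneq b c.
  by case: _ / ebc in ck Gh *; exists h, id; split=> //; exact: mmap_id.
have {nab}ab : a < b by rewrite lt_neqAle nab.
have {nbc}bc : b < c by rewrite lt_neqAle nbc.
case: Gh => [[eac _]|[_ [f Ff hf]]]; first by move: (lt_trans ab bc); rewrite eac ltxx.
move: Ff; rewrite (morass_P2 MF ab bc ck) => -[f2 Ff2 [f1 Ff1 e]].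
exists (total_ext f1), (total_ext f2); split.
- by right; split=> //; exists f1 => // x; exact: total_extE.
- by right; split=> //; exists f2 => // x; exact: total_extE.
- by move=> x xa; rewrite (hf (to_below xa)) (total_extE f1 (to_below xa)) total_extE -e.
Qed.

Lemma mmap_limit l a0 a1 h0 h1 : is_limit l -> l <= kappa -> a0 < l -> a1 < l ->
  mmap a0 l h0 -> mmap a1 l h1 ->
  exists a g0 g1 k, [/\ a < l, mmap a0 a g0, mmap a1 a g1, mmap a l k &
   (forall x, x < theta a0 -> h0 x = k (g0 x)) /\
   (forall x, x < theta a1 -> h1 x = k (g1 x))].
Proof.
move=> ll lk a0l a1l.
case=> [[e _]|[_ [f0 F0 hf0]]]; first by rewrite e ltxx in a0l.
case=> [[e _]|[_ [f1 F1 hf1]]]; first by rewrite e ltxx in a1l.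
have [a [al a0a a1a [g0 [g1 [k [G0 G1 K e0 e1]]]]]] :=
  morass_P4 MF ll lk a0l a1l F0 F1.
exists a, (total_ext g0), (total_ext g1), (total_ext k); split=> //.
- by right; split=> //; exists g0 => // x; exact: total_extE.
- by right; split=> //; exists g1 => // x; exact: total_extE.
- by right; split=> //; exists k => // x; exact: total_extE.
split=> x xa.
  by rewrite (hf0 (to_below xa)) (total_extE g0 (to_below xa)) total_extE e0.
by rewrite (hf1 (to_below xa)) (total_extE g1 (to_below xa)) total_extE e1.
Qed.

Lemma mmap_surj b y : ofin 0 < b -> b <= kappa -> y < theta b ->
  exists a h x, [/\ a < b, mmap a b h, x < theta a & h x = y].
Proof.
move=> b0 bk yb; have : [set: below (theta b)] (to_below yb) by [].
rewrite (morass_P5 MF b0 bk) => -[a ab [f Ff [x _ fx]]].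
exists a, (total_ext f), (val x); split=> //; last by rewrite total_extE fx.
  by right; split=> //; exists f => // z; exact: total_extE.
exact: below_lt.
Qed.

Definition delta (a : Ord) : Ord := xget (ofin 0) [set d |
  [/\ ofin 0 < d < theta a,
      theta (osucc a) = oadd (theta a) (osub (theta a) d)
    & F a (osucc a) = [set f | (forall x, val (f x) = val x) \/
        (forall x, val (f x) = tau d (theta a) (val x))]]].

Definition shift (a : Ord) : Ord -> Ord := tau (delta a) (theta a).

Lemma deltaP a : a < kappa -> [/\ ofin 0 < delta a < theta a,
      theta (osucc a) = oadd (theta a) (osub (theta a) (delta a))
    & F a (osucc a) = [set f | (forall x, val (f x) = val x) \/
        (forall x, val (f x) = shift a (val x))]].
Proof.
move=> ak; rewrite /shift /delta; have [d dP] := morass_P3 MF ak.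
by case: xgetP => [_ -> //|/(_ d)].
Qed.

Lemma delta_gt0 a : a < kappa -> ofin 0 < delta a.
Proof. by move=> /deltaP [/andP[]]. Qed.

Lemma delta_lt a : a < kappa -> delta a < theta a.
Proof. by move=> /deltaP [/andP[]]. Qed.

Lemma shift_id a x : x < delta a -> shift a x = x.
Proof. by rewrite /shift /tau => ->. Qed.

Lemma shift_ge a x : delta a <= x -> theta a <= shift a x.
Proof. by rewrite /shift /tau leNgt => /negPf ->; exact: le_oaddr. Qed.

(** The shift sends every grade from [delta a] on beyond [theta a], so the layer and its shifted
    copy can meet only in the grades below [delta a]. *)
Lemma shift_idE a x : shift a x < theta a -> shift a x = x.
Proof.
by move=> xs; apply: shift_id; rewrite ltNge; apply: contraL xs => /shift_ge; rewrite leNgt.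
Qed.

Lemma theta_succ a : a < kappa -> theta a <= theta (osucc a).
Proof. by move=> /deltaP [_ e _]; rewrite e; exact: le_oaddr. Qed.

Lemma mmap_succ a h : a < kappa -> mmap a (osucc a) h ->
  (forall x, x < theta a -> h x = x) \/ (forall x, x < theta a -> h x = shift a x).
Proof.
move=> ak [[e _]|[_ [f]]]; first by have := lt_osucc a; rewrite -e ltxx.
have [_ _ -> [fid|fs] hf] := deltaP ak; [left|right] => x xa.
  by rewrite (hf (to_below xa)) fid.
by rewrite (hf (to_below xa)) fs.
Qed.

Lemma shift_lt_succ a x : a < kappa -> x < theta a -> shift a x < theta (osucc a).
Proof.
move=> ak xa; have [_ e _] := deltaP ak; rewrite {}e /shift /tau.
case: ifPn => [xd|]; first by apply: lt_le_trans xa (le_oaddr _ _).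
rewrite -leNgt => dx; apply: lt_oadd2l.
have dt := ltW (delta_lt ak).
have e1 : oadd (delta a) (osub x (delta a)) = x by apply/osubP.
have e2 : oadd (delta a) (osub (theta a) (delta a)) = theta a by apply/osubP.
rewrite ltNge; apply/negP => /(le_oadd2l (delta a)).
by rewrite e1 e2 leNgt xa.
Qed.

Lemma mmap_shift a : a < kappa -> mmap a (osucc a) (shift a).
Proof.
move=> ak; right; split; first exact: lt_osucc.
exists (fun x => to_below (shift_lt_succ ak (below_lt x))) => //.
by have [_ _ ->] := deltaP ak; right.
Qed.

Lemma mmap_incl a : a < kappa -> mmap a (osucc a) id.
Proof.
move=> ak; right; split; first exact: lt_osucc.
exists (fun x => to_below (lt_le_trans (below_lt x) (theta_succ ak))) => //.
by have [_ _ ->] := deltaP ak; left.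
Qed.

(* Velleman's coherence: the points of the [theta a] form a tree under the
   morass maps, along whose branches the maps are determined below the point. *)
Lemma mmap_coherent b : b <= kappa -> forall a f g x y, mmap a b f -> mmap a b g ->
  x < theta a -> y < theta a -> f x = g y ->
  x = y /\ forall z, z <= x -> f z = g z.
Proof.
elim/Ord_ind: b => b IH bk a f g x y Gf Gg xa ya fg.
have [eab|nab] := eqVneq a b.
  case: _ / eab in bk Gf Gg {IH}; move: fg; rewrite (mmap_refl Gf xa) (mmap_refl Gg ya) => <-.
  by split=> // z /le_lt_trans /(_ xa) za; rewrite (mmap_refl Gf za) (mmap_refl Gg za).
have {nab}ab : a < b by rewrite lt_neqAle nab (mmap_le Gf).
(* Both maps are factored through one [c < b], with last factors [h1] and [h2] that are already
   coherent; the induction hypothesis treats the first factors. At a successor [c] is the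
   predecessor and each last factor is the inclusion or the shift. At a limit P4 makes the last
   factors equal, and injectivity suffices. *)
suff [c [h1 [h2 [f' [g' [[cb h1h2 Gf' Gg'] [fE gE]]]]]]] : exists c h1 h2 f' g',
    [/\ c < b, (forall x y, x < theta c -> y < theta c -> h1 x = h2 y ->
       x = y /\ forall z, z <= x -> h1 z = h2 z), mmap a c f' & mmap a c g'] /\
    ((forall x, x < theta a -> f x = h1 (f' x)) /\
     (forall x, x < theta a -> g x = h2 (g' x))).
  move: fg; rewrite fE // gE // => /h1h2 [||e h12]; try exact: mmap_lt xa || exact: mmap_lt ya.
  have ck := le_trans (ltW cb) bk.
  have [exy fg'] := IH _ cb ck _ _ _ _ _ Gf' Gg' xa ya e; split=> // z zx.
  have za := le_lt_trans zx xa.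
  by rewrite fE // gE // -fg' // h12 // (mmap_mono ck Gf').
have [b0|[c bc]|bl] := ord_cases b.
- by move: ab; rewrite b0 ltNge ofin0_le.
- have cb : c < b by rewrite bc lt_osucc.
  have ac : a <= c by rewrite -lt_osuccE -bc.
  have ck : c < kappa by exact: lt_le_trans cb bk.
  have [f' [h1 [Gf' Gh1 fE]]] := mmap_factor ac (ltW cb) bk Gf.
  have [g' [h2 [Gg' Gh2 gE]]] := mmap_factor ac (ltW cb) bk Gg.
  exists c, h1, h2, f', g'; split=> //; split=> // {fE gE fg x y xa ya} x y xc yc.
  move: Gh1 Gh2; rewrite bc => /(mmap_succ ck) [] h1E /(mmap_succ ck) [] h2E;
    rewrite h1E // h2E //.
  + move=> -> ; split=> // z zy; have zc := le_lt_trans zy yc.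
    by rewrite h1E // h2E.
  (* Inclusion against shift: a value below [theta c] forces the shifted argument below [delta c],
     and up to there the shift is the identity. *)
  + move=> xs; have sc : shift c y < theta c by rewrite -xs.
    have xy : x = y by rewrite xs shift_idE.
    split=> // z zx; have zc := le_lt_trans zx xc.
    rewrite h1E // h2E // shift_id //.
    rewrite (le_lt_trans zx) // xy ltNge; apply: contraL sc => /shift_ge.
    by rewrite leNgt.
  + move=> ys; have sc : shift c x < theta c by rewrite ys.
    have xy : x = y by rewrite -ys shift_idE.
    split=> // z zx; have zc := le_lt_trans zx xc.
    rewrite h1E // h2E // shift_id //.
    rewrite (le_lt_trans zx) // ltNge; apply: contraL sc => /shift_ge.
    by rewrite leNgt.
  + move=> e; split.
      by apply: (mmap_inj _ (mmap_shift ck) xc yc e); rewrite -bc.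
    by move=> z zx; have zc := le_lt_trans zx xc; rewrite h1E // h2E.
- have [c [g0 [g1 [k [cb G0 G1 Gk [fE gE]]]]]] := mmap_limit bl bk ab ab Gf Gg.
  exists c, k, k, g0, g1; split=> //; split=> // {fE gE fg x y xa ya} x y xc yc e.
  by split=> //; exact: mmap_inj bk Gk xc yc e.
Qed.

Lemma theta_lt_kappa a : a < kappa -> theta a < kappa.
Proof. by have [_ t _] := morass_P0a MF; move=> /t /andP[]. Qed.

(** * The layers *)

(* A point is a grade with a tag. The tag [None] is that of the points of P_0, and
   [Some (a, n)] that of the new points with index n of P_(a+1); morass maps act on
   the grade only, which makes them functorial for free. *)
Local Notation code := (Ord * option (Ord * nat))%type.
Implicit Types (A : Ord -> nat -> set code) (B : nat -> set code) (h : Ord -> Ord).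

Definition act h (x : code) : code := (h x.1, x.2).

(* Indices at which the exhaustion does not grow are skipped: the corresponding new
   points would be join-irreducible without being atoms. *)
Definition fresh B n := exists2 x, B n x & forall k, (k < n)%N -> ~ B k x.

(** The bound [theta a <= eta] singles out the grades of shifted points outside the common part. *)
Definition node B a n (eta : Ord) : Prop :=
  [/\ theta a <= eta < theta (osucc a), exists2 x, B n x & shift a x.1 = eta
    & fresh B n].

(** Cut at grade [eta], this is the ideal generated by the new point [(eta, Some (a, n))]; the cut
    leaves all of [B n], whose grades are below [theta a]. *)
Definition stage B a n : set code := fun z =>
  [\/ B n z, exists2 x, B n x & z = act (shift a) x
    | exists m eta, [/\ (m <= n)%N, node B a m eta & z = (eta, Some (a, m))]].

(** The index of the layer in which a tag first occurs. [gen] lists the grades it carries there, and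
    [gen_down] the ideal below each such point. *)
Definition birth (c : option (Ord * nat)) : Ord :=
  if c is Some (a, _) then osucc a else ofin 0.

Definition gen A (c : option (Ord * nat)) : set Ord :=
  match c with
  | None => [set eta | eta < theta (ofin 0)]
  | Some (a, n) => node (A a) a n
  end.

Definition gen_down A (c : option (Ord * nat)) (eta : Ord) : set code := fun z =>
  z.1 <= eta /\
  match c with
  | None => z.2 = None
  | Some (a, n) => stage (A a) a n z
  end.

Definition layer A b : set code := fun x =>
  exists h eta, [/\ mmap (birth x.2) b h, gen A x.2 eta & h eta = x.1].

(** The ideal below [y] is transported from the layer of birth of [y] by a morass map that sends a
    generating grade to [y.1]. By coherence the result does not depend on the map chosen. *)
Definition lay_le A b (x y : code) : Prop := exists h eta z,
  [/\ mmap (birth y.2) b h, gen A y.2 eta, h eta = y.1, gen_down A y.2 eta z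
    & x = act h z].

Definition is_join A b (x y z : code) : Prop :=
  [/\ lay_le A b x z, lay_le A b y z
    & forall w, lay_le A b x w -> lay_le A b y w -> lay_le A b z w].

(** The increasing finite ideals of the layer. [exh_start] puts a point outside the common part into
    the first of them, which later makes every new point a join of an old point and a shifted
    one. *)
Record exhaustion A a B : Prop := {
  exh_sub : forall n, B n `<=` layer A a ;
  exh_fin : forall n, finite_set (B n) ;
  exh_lower : forall n x y, B n y -> lay_le A a x y -> B n x ;
  exh_join : forall n x y z, B n x -> B n y -> is_join A a x y z -> B n z ;
  exh_mono : forall m n, (m <= n)%N -> B m `<=` B n ;
  exh_cover : forall x, layer A a x -> exists n, B n x ;
  exh_start : exists2 x, B 0%N x & delta a <= x.1 }.

(* [exhaustion A b B] depends on [A] only through its values below [b]. *)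
Lemma tower_exists : exists A, forall b, A b = xget (fun=> set0) [set B | exhaustion A b B].
Proof.
pose step A b := xget (fun=> set0) [set B | exhaustion A b B].
have step_ext A A' b : (forall a, a < b -> A a = A' a) -> step A b = step A' b.
  move=> AA'.
  (* A morass map from the birth of [Some (a, n)] into [b] forces [a < b], so only values of [A]
     below [b] are consulted. *)
  have genE c h : mmap (birth c) b h -> gen A c = gen A' c /\ gen_down A c = gen_down A' c.
    case: c => [[a n]|] //= /mmap_le; rewrite le_osucc => ab.
    by rewrite /gen_down AA'.
  have layE : layer A b = layer A' b.
    apply: funext => x; apply/propext.
    by split=> -[h [eta [Gh gx hx]]]; exists h, eta; split=> //;
      move: gx; have [e1 _] := genE _ _ Gh; rewrite e1.
  have leE : lay_le A b = lay_le A' b.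
    apply: funext => x; apply: funext => y; apply/propext.
    by split=> -[h [eta [z [Gh gx hx gz ->]]]]; exists h, eta, z; split=> //;
      move: gx gz; have [e1 e2] := genE _ _ Gh; rewrite ?e1 ?e2.
  have joinE : is_join A b = is_join A' b.
    by rewrite /is_join leE.
  rewrite /step; congr (xget _ _); apply: funext => B; apply/propext.
  by split=> -[s f l j m c i]; split=> //; move: s l j c; rewrite ?layE ?leE ?joinE.
(* Well-founded recursion supplies values below [b] only; the others are padded with empty sets,
   which is harmless by [step_ext]. *)
pose rec b (r : forall a, a < b -> nat -> set code) :=
  step (fun a => if pselect (a < b) is left ab then r a ab else fun=> set0) b.
exists (Fix Ord_lt_wf (fun=> nat -> set code) rec) => b.
rewrite Fix_eq => [|{}b r r' rr']; last first.
  by apply: step_ext => a ab; case: pselect.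
by apply: step_ext => a ab; case: pselect.
Qed.

Definition tower : Ord -> nat -> set code := proj1_sig (cid tower_exists).

(** The recursion selects an exhaustion blindly; the selection is correct as soon as some exhaustion
    exists, which is shown once the layer is known to be a lattice. *)
Lemma towerP a B : exhaustion tower a B -> exhaustion tower a (tower a).
Proof.
move=> eB; rewrite [X in exhaustion _ _ X](proj2_sig (cid tower_exists)).
exact: (@xgetPex _ _ [set B | exhaustion tower a B]) (ex_intro _ B eB).
Qed.

(** * Points of the layers and the embeddings induced by morass maps *)

Local Notation lay := (layer tower).
Local Notation lle := (lay_le tower).
Local Notation ljoin := (is_join tower).

Lemma gen_lt c eta : gen tower c eta -> eta < theta (birth c).
Proof. by case: c => [[a n]|] //= [/andP[]]. Qed.

Lemma layer_lt b x : lay b x -> x.1 < theta b.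
Proof. by move=> [h [eta [Gh /gen_lt ge <-]]]; exact: mmap_lt Gh ge. Qed.

Lemma lay_le_layer b x y : lle b x y -> lay b y.
Proof. by move=> [h [eta [z [Gh ge he _ _]]]]; exists h, eta. Qed.

Lemma lay_le_gr b x y : b <= kappa -> lle b x y -> x.1 <= y.1.
Proof.
move=> bk [h [eta [z [Gh ge <- [ze _] ->]]]] /=.
by rewrite (mmap_mono bk Gh) ?(le_lt_trans ze) ?gen_lt.
Qed.

Lemma lay_le_lt b x y : b <= kappa -> lle b x y -> x.1 < theta b.
Proof. by move=> bk xy; apply: le_lt_trans (lay_le_gr bk xy) (layer_lt (lay_le_layer xy)). Qed.

Lemma act_layer b b' h x : b' <= kappa -> mmap b b' h -> lay b x -> lay b' (act h x).
Proof.
move=> bk Gh [g [eta [Gg ge gx]]]; exists (h \o g), eta; split=> //.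
  exact: mmap_comp Gh.
by rewrite /= gx.
Qed.

Lemma act_le b b' h x y : b' <= kappa -> mmap b b' h -> lle b x y ->
  lle b' (act h x) (act h y).
Proof.
move=> bk Gh [g [eta [z [Gg ge gy gz ->]]]]; exists (h \o g), eta, z; split=> //.
  exact: mmap_comp Gh.
by rewrite /= gy.
Qed.

Lemma act_inj b b' h x y : b' <= kappa -> mmap b b' h -> x.1 < theta b -> y.1 < theta b ->
  act h x = act h y -> x = y.
Proof.
case: x y => [g c] [g' c'] bk Gh /= xb yb [e ->]; congr (_, _).
exact: mmap_inj Gh xb yb e.
Qed.

(** Coherence at work: the map generating [act h y] and the composite of [h] with the map generating
    [y] agree up to the common grade [eta], hence on the whole ideal below. Induced embeddings thus
    have lower sets as images. *)
Lemma act_down b b' h w y : b' <= kappa -> mmap b b' h -> lay b y ->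
  lle b' w (act h y) -> exists2 x, lle b x y & w = act h x.
Proof.
move=> bk Gh [g [eta [Gg ge gy]]] [k [eta' [z [Gk ge' /= ky gz ->]]]].
have := mmap_coherent bk Gk (mmap_comp bk Gg Gh) (gen_lt ge') (gen_lt ge).
rewrite /= gy ky => /(_ erefl) [e hk]; rewrite e in ge' gz hk.
exists (act g z); first by exists g, eta, z.
by rewrite /act /= hk //; case: gz.
Qed.

Lemma act_leE b b' h x y : b' <= kappa -> mmap b b' h -> lay b x -> lay b y ->
  lle b' (act h x) (act h y) -> lle b x y.
Proof.
move=> bk Gh Px Py /(act_down bk Gh Py) [x' x'y e].
by rewrite (act_inj bk Gh (layer_lt Px) (lay_le_lt (le_trans (mmap_le Gh) bk) x'y) e).
Qed.

Lemma layer_factor a b x : a <= b -> b <= kappa -> lay b x -> birth x.2 <= a ->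
  exists h x0, [/\ mmap a b h, lay a x0 & x = act h x0].
Proof.
case: x => g c /= ab bk [h [eta [/= Gh ge <-]]] ca.
have [h1 [h2 [G1 G2 e]]] := mmap_factor ca ab bk Gh.
exists h2, (h1 eta, c); split=> //; first by exists h1, eta.
by rewrite /act /= e // gen_lt.
Qed.

Lemma act_eq a f g x : (forall z, z < theta a -> f z = g z) -> lay a x -> act f x = act g x.
Proof. by move=> fg /layer_lt xa; rewrite /act fg. Qed.

Lemma act_id x : act id x = x. Proof. by case: x. Qed.

Lemma layer_incl a x : a < kappa -> lay a x -> lay (osucc a) x.
Proof.
move=> ak /(act_layer _ (mmap_incl ak)); rewrite act_id; apply.
by rewrite le_osucc.
Qed.

Lemma layer_shift a x : a < kappa -> lay a x -> lay (osucc a) (act (shift a) x).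
Proof. by move=> ak; apply: act_layer (mmap_shift ak); rewrite le_osucc. Qed.

Lemma layer_node a n eta : node (tower a) a n eta -> lay (osucc a) (eta, Some (a, n)).
Proof. by move=> ne; exists id, eta; split=> //=; exact: mmap_id. Qed.

Lemma layer_succ a x : a < kappa -> lay (osucc a) x ->
  [\/ lay a x, exists2 x0, lay a x0 & x = act (shift a) x0
    | exists n eta, node (tower a) a n eta /\ x = (eta, Some (a, n))].
Proof.
move=> ak Px; have Sk : osucc a <= kappa by rewrite le_osucc.
have [xa|xa] := leP (birth x.2) a.
  have [h [x0 [Gh Px0 ->]]] := layer_factor (ltW (lt_osucc a)) Sk Px xa.
  have [hE|hE] := mmap_succ ak Gh; rewrite (act_eq hE Px0).
    by constructor 1; rewrite act_id.
  by constructor 2; exists x0.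
constructor 3; case: x Px xa => g [[a' n]|] [h [eta [/= Gh ge <-]]]; last first.
  by rewrite ltNge ofin0_le.
rewrite lt_osuccE => aa'; have := mmap_le Gh; rewrite le_osucc lt_osuccE => a'a.
have ea : a' = a by apply: le_anti; rewrite aa' a'a.
rewrite {a' aa' a'a}ea in Gh ge *.
exists n, eta; split=> //.
by rewrite (mmap_refl Gh) //; exact: (@gen_lt (Some (a, n)) _ ge).
Qed.

Lemma lay_le_node a n eta w : node (tower a) a n eta ->
  lle (osucc a) w (eta, Some (a, n)) <-> stage (tower a) a n w /\ w.1 <= eta.
Proof.
move=> ne; have et : eta < theta (osucc a) by case: ne => /andP[].
split=> [[h [eta' [z [/= Gh ge he [ze sz] ->]]]]|[sw we]]; last first.
  by exists id, eta, w; split=> //; [exact: mmap_id | case: w {sw we}].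
have et' : eta' < theta (osucc a) by exact: (@gen_lt (Some (a, n)) _ ge).
move: he; rewrite (mmap_refl Gh) // => e; rewrite {}e in ge ze et'.
have -> : act h z = z.
  by rewrite /act (mmap_refl Gh) ?(le_lt_trans ze) //; case: z {ze sz}.
by [].
Qed.

(** Births in a limit layer are strictly below [l], so P4 passes the two generating maps through a
    single earlier layer. *)
Lemma layer_limit l x y : is_limit l -> l <= kappa -> lay l x -> lay l y ->
  exists a h x0 y0, [/\ a < l, mmap a l h, lay a x0 /\ lay a y0, x = act h x0 & y = act h y0].
Proof.
move=> ll lk Px Py.
have lim z : lay l z -> birth z.2 < l.
  case: z => g [[a n]|] [h [eta [/= Gh _ _]]]; last exact: limit_gt0.
  by apply: limit_succ => //; rewrite -le_osucc; exact: mmap_le Gh.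
case: x y Px Py (lim x) (lim y) => [g c] [g' c'] Px Py.
move=> /(_ Px) /= cl /(_ Py) /= c'l.
have [h [eta [/= Gh ge hx]]] := Px; have [h' [eta' [/= Gh' ge' hy]]] := Py.
have [a [g0 [g1 [k [al G0 G1 Gk [e0 e1]]]]]] := mmap_limit ll lk cl c'l Gh Gh'.
exists a, k, (g0 eta, c), (g1 eta', c'); split=> //.
- by split; [exists g0, eta | exists g1, eta'].
- by rewrite /act /= -e0 ?hx ?gen_lt.
- by rewrite /act /= -e1 ?hy ?gen_lt.
Qed.

Lemma lay_birth b x : lay b x -> birth x.2 <= b.
Proof. by move=> [h [eta [/mmap_le]]]. Qed.

Lemma lay_not_node a n x : lay a x -> x.2 <> Some (a, n).
Proof. by move=> /lay_birth + e; rewrite e /= le_osucc ltxx. Qed.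

Lemma mmap_max a b h x y : b <= kappa -> mmap a b h -> x < theta a -> y < theta a ->
  h (Order.max x y) = Order.max (h x) (h y).
Proof.
move=> bk Gh xa ya; case: (leP x y) => xy.
  by rewrite max_r // (mmap_mono bk Gh).
by rewrite max_l // ltW // (mmap_mono_lt bk Gh).
Qed.

(** * The layers are lattices *)

(** The invariant of the induction on [b]. [lay_pres] is carried along because joins in a limit
    layer are computed in earlier layers. [lay_surj] starts the exhaustions at grade [delta] and
    finally bounds the cardinality from below. *)
Record good b : Prop := {
  lay_refl : forall x, lay b x -> lle b x x ;
  lay_in : forall x y, lle b x y -> lay b x ;
  lay_trans : forall y x z, lle b x y -> lle b y z -> lle b x z ;
  lay_anti : forall x y, lle b x y -> lle b y x -> x = y ;
  lay_fin : forall y, lay b y -> finite_set [set x | lle b x y] ;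
  lay_join : forall x y, lay b x -> lay b y ->
    exists2 z, ljoin b x y z & z.1 = Order.max x.1 y.1 ;
  lay_surj : forall g, g < theta b -> exists2 x, lay b x & x.1 = g ;
  lay_pres : forall a h x y z, mmap a b h -> ljoin a x y z ->
    ljoin b (act h x) (act h y) (act h z) }.

Lemma join_layer b x y z : good b -> ljoin b x y z -> [/\ lay b x, lay b y & lay b z].
Proof.
by move=> gb [xz yz _]; split; 
  [exact: (lay_in gb xz) | exact: (lay_in gb yz) | exact: lay_le_layer xz].
Qed.

Lemma join_uniq b x y z z' : good b -> ljoin b x y z -> ljoin b x y z' -> z = z'.
Proof.
by move=> gb [xz yz lz] [xz' yz' lz']; apply: (lay_anti gb); [exact: lz | exact: lz'].
Qed.

Lemma join_gr b x y z : good b -> ljoin b x y z -> z.1 = Order.max x.1 y.1.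
Proof.
move=> gb jz; have [Px Py _] := join_layer gb jz.
by have [z' jz' <-] := lay_join gb Px Py; rewrite (join_uniq gb jz jz').
Qed.

Lemma join_act_refl b h x y z : b <= kappa -> mmap b b h -> ljoin b x y z ->
  ljoin b (act h x) (act h y) (act h z).
Proof.
move=> bk Gh jz; have [xz yz _] := jz.
have hE u : u.1 < theta b -> act h u = u.
  by case: u => g c ub; rewrite /act (mmap_refl Gh).
by rewrite !hE // ?(lay_le_lt bk xz) ?(lay_le_lt bk yz) ?(layer_lt (lay_le_layer xz)).
Qed.

Lemma lay0 x : lay (ofin 0) x <-> x.2 = None /\ x.1 < theta (ofin 0).
Proof.
split=> [Px|[x2 x1]]; last first.
  by exists id, x.1; rewrite x2; split=> //; exact: mmap_id.
split; last exact: layer_lt.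
by have := lay_birth Px; case: x.2 => // -[a n] /=; rewrite le_osucc ltNge ofin0_le.
Qed.

Lemma lay_le0 x y : lle (ofin 0) x y <->
  [/\ x.2 = None, y.2 = None, y.1 < theta (ofin 0) & x.1 <= y.1].
Proof.
split=> [xy|[x2 y2 yt xy]]; last first.
  by exists id, y.1, x; rewrite y2; split=> //; [exact: mmap_id | case: x {x2 xy}].
have /lay0 [y2 yt] := lay_le_layer xy; split=> //.
  by case: xy => h [eta [z [_ _ _ [_]]]]; rewrite y2 => z2 ->.
by apply: (lay_le_gr _ xy); exact: ofin0_le.
Qed.

(** Since [theta (ofin 0) = ofin 2], the first layer is a chain of two points, both tagged
    [None]. *)
Lemma good0 : good (ofin 0).
Proof.
have [t0 _ _] := morass_P0a MF.
split.
- by move=> x /lay0 [x2 xt]; apply/lay_le0.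
- by move=> x y /lay_le0 [x2 _ yt xy]; apply/lay0; split=> //; exact: le_lt_trans yt.
- move=> y x z /lay_le0 [x2 _ _ xy] /lay_le0 [_ z2 zt yz]; apply/lay_le0; split=> //.
  exact: le_trans yz.
- move=> [x c] [y d] /lay_le0 [/= -> -> _ xy] /lay_le0 [_ _ _ /= yx].
  by congr (_, _); apply: le_anti; rewrite xy yx.
- move=> y _; apply: (@sub_finite_set _ _ [set (ofin 0, None); (ofin 1, None)]).
    move=> [x c] /lay_le0 [/= -> _ + xy]; rewrite t0 => /(le_lt_trans xy) /lt_ofin.
    by move=> [[|[|]] // _ ->]; [left | right].
  by rewrite finite_setU; split; exact: finite_set1.
- move=> x y /lay0 [x2 xt] /lay0 [y2 yt].
  have mt : Order.max x.1 y.1 < theta (ofin 0) by rewrite gt_max xt.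
  exists (Order.max x.1 y.1, None) => //; split.
  + by apply/lay_le0; split=> //=; rewrite le_max lexx.
  + by apply/lay_le0; split=> //=; rewrite le_max lexx orbT.
  + move=> w /lay_le0 [_ w2 wt xw] /lay_le0 [_ _ _ yw]; apply/lay_le0; split=> //=.
    by rewrite ge_max xw.
- by move=> g g0; exists (g, None) => //; apply/lay0.
- move=> a h x y z Gh; have a0 : a = ofin 0.
    by apply: le_anti; rewrite ofin0_le (mmap_le Gh).
  by rewrite a0 in Gh *; apply: join_act_refl Gh; exact: ofin0_le.
Qed.

Lemma good_limit l : is_limit l -> l <= kappa -> (forall a, a < l -> good a) -> good l.
Proof.
move=> ll lk IH.
have reach x : lay l x -> exists a h x0, [/\ a < l, mmap a l h, lay a x0 & x = act h x0].
  by move=> Px; have [a [h [x0 [_ [al Gh [Px0 _] -> _]]]]] := layer_limit ll lk Px Px; exists a, h, x0.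
have pres a h x y z : mmap a l h -> ljoin a x y z -> ljoin l (act h x) (act h y) (act h z).
  move=> Gh jz; have [al|la] := ltP a l; last first.
    have al : a = l by apply: le_anti; rewrite la (mmap_le Gh).
    by rewrite al in Gh jz; exact: join_act_refl Gh jz.
  have ak := le_trans (ltW al) lk.
  have [Px Py Pz] := join_layer (IH _ al) jz.
  have [xz yz lz] := jz; split; [exact: act_le xz | exact: act_le yz |].
  move=> w xw yw.
  have [a' [h'' [w0 [_ [a'l Gh'' [Pw0 _] ew _]]]]] :=
    layer_limit ll lk (lay_le_layer xw) (lay_le_layer xw).
  (* The upper bound [w] comes from another layer [a']. P4 brings it together with the three given
     points in a layer [c], where [lay_pres] says that the image of [z] is still the join. *)
  have [c [g0 [g1 [k [cl G0 G1 Gk [e0 e1]]]]]] := mmap_limit ll lk al a'l Gh Gh''.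
  have ck := le_trans (ltW cl) lk.
  have hE u : lay a u -> act h u = act k (act g0 u).
    by move=> /layer_lt ua; rewrite /act /= e0.
  have wE : w = act k (act g1 w0) by rewrite ew /act /= e1 // (layer_lt Pw0).
  have Pw1 := act_layer ck G1 Pw0.
  have lec u : lay a u -> lle l (act h u) w -> lle c (act g0 u) (act g1 w0).
    by move=> Pu; rewrite hE // wE; apply: act_leE => //; exact: act_layer Pu.
  have [_ _ lz'] := lay_pres (IH _ cl) G0 jz.
  by rewrite hE // wE; apply: (act_le lk Gk); apply: lz'; exact: lec.
split=> //.
- move=> x /reach [a [h [x0 [al Gh Px0 ->]]]].
  by apply: (act_le lk Gh); exact: (lay_refl (IH _ al) Px0).
- move=> x y xy; have [a [h [y0 [al Gh Py0 ey]]]] := reach _ (lay_le_layer xy).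
  rewrite ey in xy; have [x0 x0y0 ->] := act_down lk Gh Py0 xy.
  by apply: (act_layer lk Gh); exact: (lay_in (IH _ al) x0y0).
- move=> y x z xy yz; have [a [h [z0 [al Gh Pz0 ez]]]] := reach _ (lay_le_layer yz).
  rewrite ez in yz *; have [y0 y0z0 ey] := act_down lk Gh Pz0 yz.
  rewrite ey in xy; have [x0 x0y0 ->] := act_down lk Gh (lay_in (IH _ al) y0z0) xy.
  by apply: (act_le lk Gh); exact: (lay_trans (IH _ al) x0y0 y0z0).
- move=> x y xy yx; have [a [h [y0 [al Gh Py0 ey]]]] := reach _ (lay_le_layer xy).
  rewrite ey in xy yx *; have [x0 x0y0 ex] := act_down lk Gh Py0 xy.
  have Px0 := lay_in (IH _ al) x0y0; rewrite ex in yx *.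
  by rewrite (lay_anti (IH _ al) x0y0 (act_leE lk Gh Py0 Px0 yx)).
- move=> y /reach [a [h [y0 [al Gh Py0 ->]]]].
  apply: sub_finite_set (finite_image (act h) (lay_fin (IH _ al) Py0)) => x.
  by move=> /(act_down lk Gh Py0) [x0 x0y0 ->]; exists x0.
- move=> x y Px Py; have [a [h [x0 [y0 [al Gh [Px0 Py0] -> ->]]]]] := layer_limit ll lk Px Py.
  have [z jz zE] := lay_join (IH _ al) Px0 Py0.
  exists (act h z); first exact: (pres _ _ _ _ _ Gh jz).
  by rewrite /= zE; apply: (mmap_max lk Gh); exact: layer_lt.
- move=> g gl; have [a [h [x [al Gh xa <-]]]] := mmap_surj (limit_gt0 ll) lk gl.
  have [x0 Px0 <-] := lay_surj (IH _ al) xa.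
  by exists (act h x0) => //; exact: (act_layer lk Gh Px0).
Qed.

Lemma countable_birth o : o < kappa -> countable [set c | birth c <= o].
Proof.
move=> ok.
pose E (i : bool) := if i then [set None] else [set Some p | p in below o `*` [set: nat]].
apply: (@sub_countable _ _ _ (\bigcup_i E i)).
  apply: subset_card_le => -[[a n]|] co; last by exists true.
  by exists false => //; exists (a, n) => //; split=> //; move: co; rewrite /= le_osucc.
apply: bigcup_countable => // -[] _ //; first exact: countable1.
apply: (sub_countable (card_image_le _ _)).
by apply: countableX => //; exact: countable_below.
Qed.

Lemma countable_layer a : a < kappa -> countable (lay a).
Proof.
move=> ak; apply: (@sub_countable _ _ _ (below (theta a) `*` [set c | birth c <= a])).
  by apply: subset_card_le => x Px; split; [exact: (layer_lt Px) | exact: lay_birth].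
by apply: countableX; [exact: countable_below (theta_lt_kappa ak) | exact: countable_birth].
Qed.

(** The layer is countable, so principal ideals along an increasing cofinal sequence [c] of iterated
    joins form an exhaustion; starting at a point of grade [delta a] gives [exh_start]. *)
Lemma exhaustion_tower a : a < kappa -> good a -> exhaustion tower a (tower a).
Proof.
move=> ak ga.
have [x0 Px0 x0d] := lay_surj ga (delta_lt ak).
have /choice [j jP] (p : code * code) : exists z, lay a p.1 -> lay a p.2 -> ljoin a p.1 p.2 z.
  have [P1|] := pselect (lay a p.1); last by exists x0.
  have [P2|] := pselect (lay a p.2); last by exists x0.
  by have [z jz _] := lay_join ga P1 P2; exists z.
have /countable_injP [f finj] := countable_layer ak.
(* An enumeration of the layer; indices outside the range of [f] receive [x0]. *)
have /choice [e eP] (n : nat) : exists x, lay a x /\ forall y, lay a y -> f y = n -> x = y.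
  have [[y Py fy]|ny] := pselect (exists2 y, lay a y & f y = n).
    by exists y; split=> // z Pz fz; apply: finj; rewrite ?inE // fy fz.
  by exists x0; split=> // y Py fy; case: ny; exists y.
pose c := fix c n := if n is n'.+1 then j (c n', e n') else x0.
have Pc n : lay a (c n).
  elim: n => [|n IH] //=.
  by have [_ _] := join_layer ga (jP (c n, e n) IH (eP n).1).
have cS n : lle a (c n) (c n.+1) /\ lle a (e n) (c n.+1).
  by have [? ?] := jP (c n, e n) (Pc n) (eP n).1.
have cmono m n : (m <= n)%N -> lle a (c m) (c n).
  elim: n => [|n IH]; first by rewrite leqn0 => /eqP ->; exact: (lay_refl ga).
  rewrite leq_eqVlt => /orP [/eqP ->|]; first exact: (lay_refl ga).
  by rewrite ltnS => /IH cm; exact: (lay_trans ga cm (cS n).1).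
apply: (@towerP _ (fun n x => lle a x (c n))); split.
- by move=> n x xc; exact: (lay_in ga xc).
- by move=> n; exact: (lay_fin ga).
- by move=> n x y yc xy; exact: (lay_trans ga xy yc).
- by move=> n x y z xc yc [_ _]; apply.
- by move=> m n mn x xc; exact: (lay_trans ga xc (cmono _ _ mn)).
- move=> x Px; exists (f x).+1; have := (cS (f x)).2.
  by rewrite ((eP (f x)).2 x Px erefl).
- by exists x0; rewrite ?x0d //; exact: (lay_refl ga).
Qed.

(** * The successor step: amalgamating a layer with its shifted copy *)

Section Successor.
Variable a : Ord.
Hypotheses (ak : a < kappa) (ga : good a).
Local Notation sh := (act (shift a)).
Local Notation b := (osucc a).
Local Notation T := (tower a).
Local Notation S := (stage T a).

Let ex : exhaustion tower a T := exhaustion_tower ak ga.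

Lemma succ_le_kappa : b <= kappa. Proof. by rewrite le_osucc. Qed.
Let bk := succ_le_kappa.

Lemma lay_le_incl w y : lay a y -> lle b w y <-> lle a w y.
Proof.
move=> Py; split=> [|wy].
  by rewrite -{1}[y]act_id => /(act_down bk (mmap_incl ak) Py) [x xy ->]; rewrite act_id.
by rewrite -[w]act_id -[y]act_id; apply: act_le (mmap_incl ak) wy.
Qed.

Lemma lay_le_shift w y : lay a y -> lle b w (sh y) <-> exists2 x, lle a x y & w = sh x.
Proof.
move=> Py; split=> [|[x xy ->]]; first exact: act_down (mmap_shift ak) Py.
exact: act_le (mmap_shift ak) xy.
Qed.

Lemma node_ge n eta : node T a n eta -> theta a <= eta.
Proof. by case=> /andP[]. Qed.

Lemma act_shift_id x : (sh x).1 < theta a -> sh x = x.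
Proof. by case: x => g c /= /shift_idE e; rewrite /act /= e. Qed.

Lemma lay_old x : lay b x -> x.1 < theta a -> lay a x.
Proof.
move=> /(layer_succ ak) [//|[x0 Px0 ->] xt|[n [eta [ne ->]]] /=].
  by rewrite act_shift_id.
by rewrite ltNge (node_ge ne).
Qed.

Lemma stage_lay n z : S n z -> lay b z.
Proof.
move=> [Tz|[x Tx ->]|[m [eta [_ ne ->]]]].
- by apply: layer_incl ak _; exact: (exh_sub ex Tz).
- by apply: layer_shift ak _; exact: (exh_sub ex Tx).
- exact: layer_node.
Qed.

(** A shifted point that is also old lies in the common part, where the shift is the identity. *)
Lemma stage_old n z : S n z -> lay a z -> T n z.
Proof.
move=> [//|[x Tx ->]|[m [eta [_ ne ->]]]] Pz; first by rewrite act_shift_id // (layer_lt Pz).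
by case: (lay_not_node (n := m) Pz).
Qed.

Lemma stage_shifted n z : S n (sh z) -> lay a z -> T n z.
Proof.
move=> [Tz|[x Tx e]|[m [eta [_ ne [_ e]]]]] Pz.
- by have -> // : z = sh z; rewrite act_shift_id // (layer_lt (exh_sub ex Tz)).
- by rewrite (act_inj bk (mmap_shift ak) _ _ e) ?(layer_lt Pz) // (layer_lt (exh_sub ex Tx)).
- by case: (lay_not_node (n := m) Pz).
Qed.

Lemma stage_node n m eta : S n (eta, Some (a, m)) -> (m <= n)%N.
Proof.
move=> [Tz|[x Tx [_ e]]|[m' [eta' [mn _ [_ ->]]]]] //.
  by case: (lay_not_node (n := m) (exh_sub ex Tz)).
by case: (lay_not_node (n := m) (exh_sub ex Tx)).
Qed.

Lemma stage_mono m n : (m <= n)%N -> S m `<=` S n.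
Proof.
move=> mn z [Tz|[x Tx ->]|[k [eta [km ne ->]]]].
- by constructor 1; exact: (exh_mono ex _ Tz).
- by constructor 2; exists x => //; exact: (exh_mono ex _ Tx).
- by constructor 3; exists k, eta; split=> //; exact: leq_trans mn.
Qed.

Lemma stage_cover x : lay b x -> exists n, S n x.
Proof.
move=> /(layer_succ ak) [Px|[x0 Px0 ->]|[n [eta [ne ->]]]].
- by have [n Tx] := exh_cover ex Px; exists n; constructor 1.
- by have [n Tx] := exh_cover ex Px0; exists n; constructor 2; exists x0.
- by exists n; constructor 3; exists n, eta.
Qed.

Lemma stage_lower n w z : S n z -> lle b w z -> S n w.
Proof.
move=> [Tz|[x Tx ->]|[m [eta [mn ne ->]]]].
- move=> /lay_le_incl wz; constructor 1; apply: (exh_lower ex Tz); apply: wz.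
  exact: (exh_sub ex Tz).
- move=> /lay_le_shift [|x0 x0x ->]; first exact: (exh_sub ex Tx).
  by constructor 2; exists x0 => //; exact: (exh_lower ex Tx x0x).
- by move=> /(lay_le_node _ ne) [Sw _]; exact: stage_mono mn _ Sw.
Qed.

Lemma stage_gr n z : S n z -> theta a <= z.1 -> exists2 x, T n x & shift a x.1 = z.1.
Proof.
move=> [Tz|[x Tx ->]|[m [eta [mn [_ [x Tx sx] _] ->]]]].
- by rewrite leNgt (layer_lt (exh_sub ex Tz)).
- by exists x.
- by exists x => //; exact: (exh_mono ex _ Tx).
Qed.

(** When [T n] adds no point, neither does the stage, since nodes carry fresh indices only. Index 0
    is always fresh, the first ideal being nonempty. *)
Lemma not_fresh n : ~ fresh T n -> exists2 m, (m < n)%N & S n `<=` S m.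
Proof.
move=> nf; have [x0 Tx0 _] := exh_start ex; case: n nf => [|n] nf.
  by case: nf; exists x0.
have TS : T n.+1 `<=` T n.
  move=> x Tx; apply: contrapT => nTx; apply: nf; exists x => // k kn Tk.
  by apply: nTx; exact: (exh_mono ex (_ : (k <= n)%N) Tk).
exists n => // z [Tz|[x Tx ->]|[m [eta [mn ne ->]]]].
- by constructor 1; exact: TS.
- by constructor 2; exists x => //; exact: TS.
- constructor 3; exists m, eta; split=> //; rewrite -ltnS ltn_neqAle mn andbT.
  by apply/eqP => e; apply: nf; rewrite -e; case: ne.
Qed.

Lemma finite_stage n : finite_set (S n).
Proof.
pose f m (x : code) : code := (shift a x.1, Some (a, m)).
apply: (@sub_finite_set _ _ (T n `|` (sh @` T n `|` [set f m x | m in `I_n.+1 & x in T n]))).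
  move=> z [Tz|[x Tx ->]|[m [eta [mn [_ [x Tx sx] _] ->]]]]; first by left.
    by right; left; exists x.
  right; right; exists m; first by rewrite /= ltnS.
  by exists x; [exact: (exh_mono ex mn Tx) | rewrite /f sx].
have fT := exh_fin ex n.
by rewrite !finite_setU; split=> //; split; [exact: finite_image | exact: finite_image2].
Qed.

(** The upper bound [w] can be of three kinds. If it is old, nothing changes. If it is shifted, [x]
    and [y] lie in the common part, and so does [z]. If it is new, the finite ideal of its stage
    contains [x] and [y], hence [z]. *)
Lemma join_incl x y z : ljoin a x y z -> ljoin b x y z.
Proof.
move=> jz; have [xz yz lz] := jz; have [Px Py Pz] := join_layer ga jz.
split; [exact/lay_le_incl | exact/lay_le_incl | move=> w xw yw].
have old u v : sh u = v -> lay a u -> lay a v -> u = v.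
  by move=> <- _ Pu; rewrite act_shift_id // (layer_lt Pu).
have [Pw|[w0 Pw0 ew]|[n [eta [ne ew]]]] := layer_succ ak (lay_le_layer xw).
- by apply/lay_le_incl => //; apply: lz; exact/lay_le_incl.
- rewrite ew in xw yw *.
  have [x0 x0w ex0] := (lay_le_shift _ Pw0).1 xw.
  have [y0 y0w ey0] := (lay_le_shift _ Pw0).1 yw.
  have xE := old _ _ (esym ex0) (lay_in ga x0w) Px.
  have yE := old _ _ (esym ey0) (lay_in ga y0w) Py.
  rewrite xE in x0w; rewrite yE in y0w.
  have zw := lz _ x0w y0w; apply/lay_le_shift => //; exists z => //.
  (* [sh z = z], because the grade of [z] is the maximum of two grades fixed by the shift. *)
  case: z {jz lz xz yz zw} (join_gr ga jz) Pz => g c /= -> Pz.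
  rewrite /act /= (mmap_max bk (mmap_shift ak)) ?(layer_lt Px) ?(layer_lt Py) //.
  move: ex0 ey0; rewrite xE yE.
  by move=> /(congr1 fst) /= <- /(congr1 fst) /= <-.
- rewrite ew in xw yw *.
  have [Sx xe] := (lay_le_node _ ne).1 xw; have [Sy ye] := (lay_le_node _ ne).1 yw.
  apply/(lay_le_node _ ne); split.
    by constructor 1; apply: exh_join jz => //; exact: stage_old.
  by rewrite (join_gr ga jz) ge_max xe.
Qed.

(** The case analysis is that of [join_incl] with the two copies exchanged: below an old upper
    bound, [sh x] and [sh y] belong to the common part. *)
Lemma join_shift x y z : ljoin a x y z -> ljoin b (sh x) (sh y) (sh z).
Proof.
move=> jz; have [xz yz lz] := jz; have [Px Py Pz] := join_layer ga jz.
split; [by apply/lay_le_shift => //; exists x | by apply/lay_le_shift => //; exists y | move=> w xw yw].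
have old u v : lle a (sh u) v -> sh u = u.
  by move=> uv; rewrite act_shift_id // (lay_le_lt (ltW ak) uv).
have zgr : (sh z).1 = Order.max (sh x).1 (sh y).1.
  rewrite /= (join_gr ga jz) (mmap_max bk (mmap_shift ak)) ?(layer_lt Px) ?(layer_lt Py) //.
have [Pw|[w0 Pw0 ew]|[n [eta [ne ew]]]] := layer_succ ak (lay_le_layer xw).
- have xw' := (lay_le_incl _ Pw).1 xw; have yw' := (lay_le_incl _ Pw).1 yw.
  have zt : (sh z).1 < theta a.
    by rewrite zgr gt_max (lay_le_lt (ltW ak) xw') (lay_le_lt (ltW ak) yw').
  have ex0 := old _ _ xw'; have ey0 := old _ _ yw'; rewrite ex0 in xw'; rewrite ey0 in yw'.
  by apply/lay_le_incl => //; rewrite act_shift_id //; exact: lz.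
- rewrite ew in xw yw *; apply/lay_le_shift => //; exists z => //.
  by apply: lz; exact: act_leE (mmap_shift ak) _ _ _.
- rewrite ew in xw yw *.
  have [Sx xe] := (lay_le_node _ ne).1 xw; have [Sy ye] := (lay_le_node _ ne).1 yw.
  apply/(lay_le_node _ ne); split; last by rewrite zgr ge_max xe.
  by constructor 2; exists z => //; apply: exh_join jz => //; exact: stage_shifted.
Qed.

(* The joins that are not inherited from one of the two copies of the layer. *)
Lemma join_node n eta x y : node T a n eta -> S n x -> S n y ->
  eta = Order.max x.1 y.1 -> (forall m, S m x -> S m y -> (n <= m)%N) ->
  ~ (lay a x /\ lay a y) ->
  ~ (exists x0 y0, [/\ lay a x0, lay a y0, x = sh x0 & y = sh y0]) ->
  ljoin b x y (eta, Some (a, n)).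
Proof.
move=> ne Sx Sy etaE nmin nold nshift; split.
- by apply/(lay_le_node _ ne); split; rewrite // etaE le_max lexx.
- by apply/(lay_le_node _ ne); split; rewrite // etaE le_max lexx orbT.
move=> w xw yw; have [Pw|[w0 Pw0 ew]|[m [eta' [me ew]]]] := layer_succ ak (lay_le_layer xw).
- by case: nold; split; apply: (lay_in ga); apply/lay_le_incl; eassumption.
- rewrite ew in xw yw; case: nshift.
  have [x0 x0w ->] := (lay_le_shift _ Pw0).1 xw.
  have [y0 y0w ->] := (lay_le_shift _ Pw0).1 yw.
  by exists x0, y0; split=> //; [exact: (lay_in ga x0w) | exact: (lay_in ga y0w)].
- rewrite ew in xw yw *.
  have [Sx' xe] := (lay_le_node _ me).1 xw; have [Sy' ye] := (lay_le_node _ me).1 yw.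
  apply/(lay_le_node _ me); split; last by rewrite /= etaE ge_max xe.
  by constructor 3; exists n, eta; split=> //; exact: nmin.
Qed.

Lemma good_succ : good b.
Proof.
split.
- move=> x /(layer_succ ak) [Px|[x0 Px0 ->]|[n [eta [ne ->]]]].
  + by apply/lay_le_incl => //; exact: (lay_refl ga).
  + by apply/lay_le_shift => //; exists x0 => //; exact: (lay_refl ga).
  + by apply/(lay_le_node _ ne); split=> //; constructor 3; exists n, eta.
- move=> x y xy; have [n Sy] := stage_cover (lay_le_layer xy).
  exact: stage_lay (stage_lower Sy xy).
- move=> y x z xy yz.
  have [Pz|[z0 Pz0 ez]|[n [eta [ne ez]]]] := layer_succ ak (lay_le_layer yz).
  + have yz' := (lay_le_incl _ Pz).1 yz; have Py := lay_in ga yz'.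
    by apply/lay_le_incl => //; apply: (lay_trans ga) yz'; exact/lay_le_incl.
  + rewrite ez in yz *; have [y0 y0z ey] := (lay_le_shift _ Pz0).1 yz.
    rewrite ey in xy; have [x0 x0y ex0] := (lay_le_shift _ (lay_in ga y0z)).1 xy.
    by apply/lay_le_shift => //; exists x0 => //; exact: (lay_trans ga x0y).
  + rewrite ez in yz *; have [Sy ye] := (lay_le_node _ ne).1 yz.
    apply/(lay_le_node _ ne); split; first exact: stage_lower Sy xy.
    by apply: le_trans ye; exact: lay_le_gr xy.
- move=> x y xy yx.
  have [Py|[y0 Py0 ey]|[n [eta [ne ey]]]] := layer_succ ak (lay_le_layer xy).
  + have xy' := (lay_le_incl _ Py).1 xy; have Px := lay_in ga xy'.
    by apply: (lay_anti ga xy'); exact/lay_le_incl.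
  + rewrite ey in xy yx *; have [x0 x0y ex0] := (lay_le_shift _ Py0).1 xy.
    have Px0 := lay_in ga x0y; rewrite ex0 in yx *.
    by rewrite (lay_anti ga x0y (act_leE bk (mmap_shift ak) Py0 Px0 yx)).
  + rewrite ey in xy yx *; have [Sx xe] := (lay_le_node _ ne).1 xy.
    case: Sx => [Tx|[x0 Tx0 ex0]|[m [eta' [mn me ex0]]]].
    * have Px := exh_sub ex Tx; move/(lay_le_incl _ Px): yx => /(lay_in ga) /lay_not_node.
      by move=> /(_ n) [].
    * have Px0 := exh_sub ex Tx0; rewrite ex0 in yx.
      have [y0 /(lay_in ga) /lay_not_node + [_ e]] := (lay_le_shift _ Px0).1 yx.
      by move=> /(_ n); rewrite -e => -[].
    * rewrite ex0 in yx xe *; have [/stage_node nm ee] := (lay_le_node _ me).1 yx.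
      by congr (_, Some (_, _)); [apply: le_anti; rewrite xe | apply/eqP; rewrite eqn_leq mn].
- move=> y /stage_cover [n Sy]; apply: sub_finite_set (finite_stage n) => x.
  exact: stage_lower Sy.
- move=> x y Px Py.
  have [[ox oy]|nold] := pselect (lay a x /\ lay a y).
    have [z jz zE] := lay_join ga ox oy; exists z => //; exact: join_incl.
  have [[x0 [y0 [Px0 Py0 -> ->]]]|nshift] := pselect (exists x0 y0,
      [/\ lay a x0, lay a y0, x = sh x0 & y = sh y0]).
    have [z jz zE] := lay_join ga Px0 Py0; exists (sh z); first exact: join_shift.
    by rewrite /= zE; apply: (mmap_max bk (mmap_shift ak)); exact: layer_lt.
  (* The join is the new point with the least index [n] whose stage contains both points and with
     the larger of the two grades. Minimality makes [n] fresh. *)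
  have both : exists n, `[< S n x /\ S n y >].
    have [m Sx] := stage_cover Px; have [n Sy] := stage_cover Py.
    exists (maxn m n); apply/asboolP; split; first exact: stage_mono (leq_maxl m n) _ Sx.
    exact: stage_mono (leq_maxr m n) _ Sy.
  case: (ex_minnP both) => n /asboolP [Sx Sy] nmin.
  have {}nmin m : S m x -> S m y -> (n <= m)%N by move=> ? ?; apply: nmin; exact/asboolP.
  have fn : fresh T n.
    apply: contrapT => /not_fresh [m mn nm].
    by have := nmin m (nm _ Sx) (nm _ Sy); rewrite leqNgt mn.
  set eta := Order.max x.1 y.1.
  (* With both grades below [theta a] both points would be old, a case already treated. *)
  have ge : theta a <= eta.
    rewrite leNgt; apply/negP; rewrite gt_max => /andP[xt yt].
    by apply: nold; split; exact: lay_old.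
  have [u Tu ue] : exists2 u, T n u & shift a u.1 = eta.
    move: ge; rewrite /eta; case: (leP x.1 y.1) => _; exact: stage_gr.
  have ne : node T a n eta.
    split=> //; last by exists u.
    by rewrite ge -ue; apply: shift_lt_succ => //; exact: (layer_lt (exh_sub ex Tu)).
  by exists (eta, Some (a, n)) => //; exact: join_node.
- move=> g gb; have [c [h [x [cb Gh xc <-]]]] := mmap_surj (le_lt_trans (ofin0_le a) (lt_osucc a)) bk gb.
  have ca : c <= a by rewrite -lt_osuccE.
  have [h1 [h2 [G1 G2 e]]] := mmap_factor ca (ltW (lt_osucc a)) bk Gh.
  have [x0 Px0 ex0] := lay_surj ga (mmap_lt G1 xc).
  by exists (act h2 x0); [exact: (act_layer bk G2 Px0) | rewrite /= ex0 e].
- move=> c h x y z Gh jz; have [cb|bc] := ltP c b; last first.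
    have cE : c = b by apply: le_anti; rewrite bc (mmap_le Gh).
    by rewrite cE in Gh jz; exact: join_act_refl Gh jz.
  (* A map from an earlier layer factors through layer [a], where joins are preserved by induction;
     the last factor is the inclusion or the shift. *)
  have ca : c <= a by rewrite -lt_osuccE.
  have [h1 [h2 [G1 G2 e]]] := mmap_factor ca (ltW (lt_osucc a)) bk Gh.
  have jz1 := lay_pres ga G1 jz; have [P1 P2 P3] := join_layer ga jz1.
  have ck := le_trans ca (ltW ak).
  have [xz yz _] := jz.
  have hE u : u.1 < theta c -> act h u = act h2 (act h1 u).
    by move=> uc; rewrite /act /= e.
  rewrite !hE ?(lay_le_lt ck xz) ?(lay_le_lt ck yz) ?(layer_lt (lay_le_layer xz)) //.
  have [h2E|h2E] := mmap_succ ak G2.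
    by rewrite (act_eq h2E P1) (act_eq h2E P2) (act_eq h2E P3) !act_id; exact: join_incl.
  by rewrite (act_eq h2E P1) (act_eq h2E P2) (act_eq h2E P3); exact: join_shift.
Qed.

End Successor.

Lemma good_all b : b <= kappa -> good b.
Proof.
elim/Ord_ind: b => b IH bk; have [->|[a ba]|bl] := ord_cases b; first exact: good0.
  have ab : a < b by rewrite ba lt_osucc.
  rewrite ba; apply: good_succ; first exact: lt_le_trans bk.
  by apply: IH => //; exact: le_trans (ltW ab) bk.
by apply: good_limit => // a ab; apply: IH => //; exact: le_trans (ltW ab) bk.
Qed.

(** * Lower covers and atoms *)

Lemma theta_gt0 a : a <= kappa -> ofin 0 < theta a.
Proof.
rewrite le_eqVlt => /orP [/eqP ->|ak].
  have [_ _ ->] := morass_P0a MF; have [_ + _] := csuccP kappa.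
  exact: le_lt_trans (ofin0_le _).
by have [_ t _] := morass_P0a MF; have /andP[] := t a ak.
Qed.

(** At a successor both maps fix zero because [delta] is nonzero. At a limit P5 gives zero some
    preimage; P4 moves it to a common layer [c], and monotonicity of [k] then sends the zero of
    [theta c] to zero. *)
Lemma mmap_zero b : b <= kappa -> forall a h, mmap a b h -> h (ofin 0) = ofin 0.
Proof.
elim/Ord_ind: b => b IH bk a h Gh.
have [eab|nab] := eqVneq a b.
  by rewrite eab in Gh; apply: (mmap_refl Gh); exact: theta_gt0.
have {nab}ab : a < b by rewrite lt_neqAle nab (mmap_le Gh).
have a0 := theta_gt0 (le_trans (ltW ab) bk).
have [b0|[c bc]|bl] := ord_cases b.
- by move: ab; rewrite b0 ltNge ofin0_le.
- have cb : c < b by rewrite bc lt_osucc.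
  have ac : a <= c by rewrite -lt_osuccE -bc.
  have ck : c < kappa by exact: lt_le_trans cb bk.
  have [h' [u [Gh' Gu ->]]] := mmap_factor ac (ltW cb) bk Gh; last exact: a0.
  rewrite (IH _ cb (ltW ck) _ _ Gh'); rewrite bc in Gu.
  have c0 := theta_gt0 (ltW ck).
  by have [uE|uE] := mmap_succ ck Gu; rewrite uE // shift_id // delta_gt0.
- have [a1 [h1 [x [a1b Gh1 xa1 hx]]]] := mmap_surj (limit_gt0 bl) bk (theta_gt0 bk).
  have [c [g0 [g1 [k [cb G0 G1 Gk [e0 e1]]]]]] := mmap_limit bl bk ab a1b Gh Gh1.
  rewrite e0 // (IH _ cb (le_trans (ltW cb) bk) _ _ G0).
  have c0 := theta_gt0 (le_trans (ltW cb) bk).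
  apply: le_anti; rewrite ofin0_le andbT.
  have := mmap_mono bk Gk c0 (mmap_lt G1 xa1).
  by rewrite -e1 // hx ofin0_le => ->.
Qed.

(** Morass maps fix grade zero, so the layer of birth decides; there the stage contains a nonempty
    lower set of an earlier layer, and with it the zero of that layer. *)
Lemma lay_zero b x : b <= kappa -> lay b x -> lle b (ofin 0, None) x.
Proof.
elim/Ord_ind: b x => b IH [g c] bk [h [eta [/= Gh ge hg]]].
exists h, eta, (ofin 0, None); split=> //; last first.
  by rewrite /act /= (mmap_zero bk Gh).
split; first exact: ofin0_le.
case: c Gh ge => [[a n]|] //= Gh ge.
have ab : a < b by rewrite -le_osucc; exact: mmap_le Gh.
have ak := lt_le_trans ab bk; have ga := good_all (ltW ak).
have ex := exhaustion_tower ak ga; have [x0 Tx0 _] := exh_start ex.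
have Tx := exh_mono ex (leq0n n) Tx0.
by constructor 1; apply: (exh_lower ex Tx); apply: IH; rewrite ?(ltW ak) //; exact: exh_sub Tx.
Qed.

(** At birth there are only the grades 0 and 1 with tag [None]; so the points tagged [None] are the
    zero and atoms. *)
Lemma lay_atom_le b u z : b <= kappa -> u.2 = None -> lle b z u ->
  z = (ofin 0, None) \/ z = u.
Proof.
case: u => g c /= bk -> [h [eta [[z0 c0] [/= Gh]]]].
have [-> _ _] := morass_P0a MF => /lt_ofin [m m2 em] <- [/= z0e ->] ->.
have [z1 z1m ->] : exists2 m', (m' < m.+1)%N & z0 = ofin m'.
  by apply/lt_ofin; apply: (le_lt_trans z0e); rewrite em ofin_lt.
move: z1m; rewrite ltnS leq_eqVlt => /orP [/eqP ->|z1m]; first by right; rewrite em.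
left; have -> : z1 = 0%N by case: z1 m m2 z1m {em} => [|?] [|[|?]].
by rewrite /act /= (mmap_zero bk Gh).
Qed.

Definition lay_cover b x y :=
  [/\ lle b x y, x <> y & forall z, lle b x z -> lle b z y -> z = x \/ z = y].

(** The bound three in a form that transports along embeddings: three classes, each containing at
    most one lower cover. *)
Definition few_covers b y := exists D : nat -> set code,
  (forall x, lay_cover b x y -> exists2 i, (i < 3)%N & D i x) /\
  forall i x x', D i x -> D i x' -> lay_cover b x y -> lay_cover b x' y -> x = x'.

(** This is how directedness of a class leaves room for only one lower cover in it. *)
Lemma cover_bound b x x' y z : lay_cover b x y -> lay_cover b x' y ->
  lle b x z -> lle b x' z -> lle b z y -> z <> y -> x = x'.
Proof.
by move=> [_ _ cx] [_ _ cx'] xz x'z zy nzy; case: (cx _ xz zy) => // <-; case: (cx' _ x'z zy).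
Qed.

Lemma few_covers_base eta : eta < theta (ofin 0) -> few_covers (ofin 0) (eta, None).
Proof.
move=> et; exists (fun=> setT); split=> [x _|_]; first by exists 0%N.
suff H x x' : x.1 <= x'.1 -> lay_cover (ofin 0) x (eta, None) ->
    lay_cover (ofin 0) x' (eta, None) -> x = x'.
  move=> x x' _ _ cx cx'; have [xx'|x'x] := leP x.1 x'.1; first exact: H.
  by apply/esym/H => //; exact: ltW.
move=> xx' cx cx'; have [xy _ _] := cx; have [x'y nx' _] := cx'.
have [x2 _ _ _] := (lay_le0 _ _).1 xy; have [x'2 _ _ x'e] := (lay_le0 _ _).1 x'y.
have x't : x'.1 < theta (ofin 0) by exact: le_lt_trans et.
by apply: (cover_bound cx cx') nx' => //; exact/lay_le0.
Qed.

(** * Lower covers of a new point, and its generation by joins *)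

Section NodeCovers.
Variable a : Ord.
Hypothesis ak : a < kappa.
Local Notation b := (osucc a).
Local Notation T := (tower a).
Local Notation S := (stage T a).
Local Notation sh := (act (shift a)).

Let ga : good a := good_all (ltW ak).
Let ex : exhaustion tower a T := exhaustion_tower ak ga.

Lemma node_gt n eta x : node T a n eta -> T n x -> x.1 <= eta.
Proof.
by move=> /node_ge ge Tx; apply: ltW; apply: lt_le_trans ge; exact: (layer_lt (exh_sub ex Tx)).
Qed.

Lemma node_le m n eta eta' : node T a m eta -> node T a n eta' ->
  (m <= n)%N -> eta <= eta' -> lle b (eta, Some (a, m)) (eta', Some (a, n)).
Proof.
by move=> me ne mn ee; apply/(lay_le_node _ ne); split=> //; constructor 3; exists m, eta.
Qed.

Lemma node_max m n eta eta' : node T a m eta -> node T a n eta' ->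
  node T a (maxn m n) (Order.max eta eta').
Proof.
move=> [ge [x Tx xe] fm] [ge' [x' Tx' xe'] fn]; split; last by rewrite /maxn; case: ifP.
  by case: (leP eta eta').
have mM := leq_maxl m n; have nM := leq_maxr m n.
case: (leP eta eta') => _; first by exists x' => //; exact: (exh_mono ex nM Tx').
by exists x => //; exact: (exh_mono ex mM Tx).
Qed.

Lemma few_covers_node n eta : node T a n eta -> few_covers b (eta, Some (a, n)).
Proof.
move=> ne; set y := (eta, Some (a, n)).
(* The three directed classes: shifted points; old points together with new points of the same index
   [n]; new points of smaller index. The second is directed because old points of [T n] lie below
   every new point of index [n], and these form a chain by grade; the third because of
   [node_max]. *)
pose D i : set code := match i with
  | 0 => sh @` T n
  | 1 => T n `|` [set x | exists2 e, node T a n e & x = (e, Some (a, n))]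
  | _ => [set x | exists m e, [/\ (m < n)%N, node T a m e & x = (e, Some (a, m))]]
  end%N.
exists D; split=> [x [/(lay_le_node _ ne) [Sx _] _ _]|i x x' Dx Dx' cx cx'].
  case: Sx => [Tx|[x0 Tx0 ->]|[m [e [mn me ->]]]].
  - by exists 1%N => //; left.
  - by exists 0%N => //; exists x0.
  - move: mn; rewrite leq_eqVlt => /orP [/eqP mn|mn].
      by exists 1%N => //; right; exists e; rewrite -?mn.
    by exists 2%N => //; exists m, e.
have [xy nxy _] := cx; have [x'y nx'y _] := cx'.
have [Sx xe] := (lay_le_node _ ne).1 xy; have [Sx' x'e] := (lay_le_node _ ne).1 x'y.
suff [z [Sz ze nzy xz x'z]] : exists z, [/\ S n z, z.1 <= eta, z <> y, lle b x z & lle b x' z].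
  by apply: (cover_bound cx cx' xz x'z) => //; exact/(lay_le_node _ ne).
have old u v : T n u -> T n v -> exists2 z, T n z & ljoin a u v z.
  move=> Tu Tv; have [z jz _] := lay_join ga (exh_sub ex Tu) (exh_sub ex Tv).
  by exists z => //; exact: (exh_join ex Tu Tv jz).
have oldN u : T n u -> u.2 <> Some (a, n).
  by move=> Tu; apply: lay_not_node; exact: (exh_sub ex Tu).
have old_node u e : T n u -> node T a n e -> lle b u (e, Some (a, n)).
  move=> Tu ne'; apply/(lay_le_node _ ne'); split; first by constructor 1.
  exact: node_gt ne' Tu.
move: i Dx Dx' => [|[|i]] /=.
- move=> [u Tu eu] [v Tv ev]; have [z Tz jz] := old _ _ Tu Tv.
  have [uz vz _] := join_shift ak ga jz; exists (sh z); rewrite -eu -ev; split=> //.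
  + by constructor 2; exists z.
  + rewrite /= (join_gr ga jz).
    rewrite (mmap_max _ (mmap_shift ak)) ?(layer_lt (exh_sub ex Tu)) ?(layer_lt (exh_sub ex Tv)) //.
      by rewrite ge_max; move: xe x'e; rewrite -eu -ev /= => -> ->.
    by rewrite le_osucc.
  + by move=> [_ /(oldN _ Tz)].
- move=> [Tx|[e ne' ee]] [Tx'|[e' ne'' ee']].
  + have [z Tz jz] := old _ _ Tx Tx'; have [xz x'z _] := join_incl ak ga jz.
    exists z; split=> //; first by constructor 1.
      exact: node_gt ne Tz.
    by move=> zy; have := oldN _ Tz; rewrite zy.
  + by exists x'; split=> //; rewrite ee'; [exact: old_node | exact: (lay_refl (good_succ ak ga) (layer_node ne''))].
  + by exists x; split=> //; rewrite ee; [exact: (lay_refl (good_succ ak ga) (layer_node ne')) | exact: old_node].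
  + rewrite ee ee' in Sx Sx' xe x'e nxy nx'y *.
    have [eE|eE] := leP e e'.
      by exists (e', Some (a, n)); split=> //; exact: node_le.
    by exists (e, Some (a, n)); split=> //; apply: node_le => //; exact: ltW.
- move=> [m [e [mn me ee]]] [m' [e' [m'n me' ee']]].
  have M := node_max me me'; rewrite ee ee' in xe x'e *.
  have mmn : (maxn m m' < n)%N by rewrite gtn_max mn.
  exists (Order.max e e', Some (a, maxn m m')); split.
  + by constructor 3; exists (maxn m m'), (Order.max e e'); split=> //; exact: ltnW.
  + by rewrite /= ge_max xe.
  + by move=> [_ en]; rewrite en ltnn in mmn.
  + by apply: node_le => //; [exact: leq_maxl | rewrite le_max lexx].
  + by apply: node_le => //; [exact: leq_maxr | rewrite le_max lexx orbT].
Qed.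

(* Closure under the inherited joins suffices to reach a node, since it is the
   join of an old point outside the common part and a shifted one. *)
Lemma node_generated n eta (I : set code) : node T a n eta ->
  (forall u v z, I u -> I v -> ljoin b u v z -> I z) ->
  T n `<=` I -> (forall u, T n u -> (sh u).1 <= eta -> I (sh u)) ->
  I (eta, Some (a, n)).
Proof.
move=> ne Ijoin IT Ish; have [_ [y0 Ty0 y0e] [x0 Tx0 x0n]] := ne.
have [x1 Tx1 x1d] := exh_start ex.
have Tx1n := exh_mono ex (leq0n n) Tx1.
(* [x0] witnesses that [n] is fresh and [x1] has grade at least [delta a]. Their join [x2] therefore
   enters at stage [n] exactly and is not a shifted point. *)
have [x2 j2 x2E] := lay_join ga (exh_sub ex Tx0) (exh_sub ex Tx1n).
have Tx2 : T n x2 by exact: (exh_join ex Tx0 Tx1n j2).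
have [x02 _ _] := j2; have Px2 := exh_sub ex Tx2.
have x2t := layer_lt Px2; have ge := node_ge ne.
apply: (Ijoin x2 (sh y0)); [exact: IT | by apply: Ish; rewrite //= y0e |].
apply: join_node => //.
- by constructor 1.
- by constructor 2; exists y0.
- by rewrite /= y0e max_r // ltW // (lt_le_trans x2t).
- move=> m Sx2 _; rewrite leqNgt; apply/negP => mn; apply: (x0n m mn).
  exact: (exh_lower ex (stage_old Sx2 Px2) x02).
- by move=> [_ /layer_lt /=]; rewrite y0e ltNge ge.
- move=> [u [_ [Pu _ e _]]]; have ut := x2t; rewrite e in ut.
  have uE := act_shift_id ut; have : delta a <= u.1.
    by rewrite -uE -e x2E le_max x1d orbT.
  by move=> /shift_ge; rewrite -[shift a u.1]/(sh u).1 leNgt ut.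
Qed.

End NodeCovers.

(** The embedding from the layer of birth maps onto a lower set, so all lower covers of [y] are
    images of lower covers there. *)
Lemma lay_covers b y : b <= kappa -> lay b y -> few_covers b y.
Proof.
move=> bk [h [eta [Gh ge hy]]]; have yE : y = act h (eta, y.2) by rewrite /act /= hy; case: y {Gh ge hy}.
have bk' := le_trans (mmap_le Gh) bk.
have Py0 : lay (birth y.2) (eta, y.2) by exists id, eta; split=> //; exact: mmap_id.
have [D [D3 Dinj]] : few_covers (birth y.2) (eta, y.2).
  case: y.2 ge {Gh hy yE Py0} bk' => [[a n]|] ge bk'; last exact: few_covers_base.
  by apply: few_covers_node ge; rewrite -le_osucc.
have down x : lay_cover b x y -> exists2 x0, lay_cover (birth y.2) x0 (eta, y.2) & x = act h x0.
  rewrite {1}yE => -[xy nxy cx]; have [x0 x0y e] := act_down bk Gh Py0 xy.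
  exists x0 => //; split=> //; first by move=> e0; apply: nxy; rewrite e e0.
  move=> z x0z zy; have [] := cx (act h z).
  - by rewrite e; exact: act_le x0z.
  - exact: act_le zy.
  - rewrite e => /(act_inj bk Gh); rewrite (lay_le_lt bk' zy) (lay_le_lt bk' x0y).
    by move=> /(_ isT isT); left.
  - move=> /(act_inj bk Gh); rewrite (lay_le_lt bk' zy) (layer_lt Py0).
    by move=> /(_ isT isT); right.
exists (fun i => act h @` [set x0 | D i x0 /\ lay_cover (birth y.2) x0 (eta, y.2)]).
split=> [x /down [x0 c0 ->]|i _ _ [u [Du cu] <-] [v [Dv cv] <-] _ _].
  by have [i i3 Di] := D3 _ c0; exists i => //; exists x0.
by rewrite (Dinj _ _ _ Du Dv cu cv).
Qed.

(** Atomisticity as an induction principle: taking for [I] the points below an upper bound of the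
    atoms under [x] shows that [x] is their least upper bound. *)
Lemma lay_atomistic b : b <= kappa -> forall x (I : set code), lay b x ->
  (forall u v z, I u -> I v -> ljoin b u v z -> I z) ->
  (forall u, u.2 = None -> lle b u x -> I u) -> I x.
Proof.
elim/Ord_ind: b => b IH bk x I Px Ijoin Iatom.
have [h [eta [Gh ge hx]]] := Px.
have xE : x = act h (eta, x.2) by rewrite /act /= hx; case: x {Px Iatom Gh ge hx}.
case x2 : x.2 => [[a n]|]; last by apply: Iatom => //; exact: (lay_refl (good_all bk)).
rewrite x2 /= in Gh ge xE; have ab : a < b by rewrite -le_osucc; exact: mmap_le Gh.
have ak := lt_le_trans ab bk; have ga := good_all (ltW ak).
have ex := exhaustion_tower ak ga.
(* The pullback of [I] along [h] is still closed under joins by [lay_pres], so the argument moves to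
   the layer of birth. There the induction hypothesis for layer [a] is used twice, along the
   inclusion and along the shift. *)
have Ijoin' u v z : I (act h u) -> I (act h v) -> ljoin (osucc a) u v z -> I (act h z).
  by move=> Iu Iv jz; apply: (Ijoin _ _ _ Iu Iv); exact: (lay_pres (good_all bk) Gh jz).
have Iatom' u : u.2 = None -> lle (osucc a) u (eta, Some (a, n)) -> I (act h u).
  by move=> u2 ux; apply: Iatom => //; rewrite xE; exact: (act_le bk Gh).
rewrite xE; apply: (@node_generated a ak n eta (fun z => I (act h z)) ge Ijoin').
- move=> u Tu; have Pu := exh_sub ex Tu.
  apply: (IH a ab (ltW ak) u (fun z => I (act h z)) Pu).
    by move=> v w z Iv Iw jz; apply: (Ijoin' _ _ _ Iv Iw); exact: join_incl.
  move=> v v2 vu; apply: Iatom' => //; apply/(lay_le_node _ ge); split.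
    by constructor 1; exact: (exh_lower ex Tu vu).
  exact: (node_gt ak ge (exh_lower ex Tu vu)).
- move=> u Tu ue; have Pu := exh_sub ex Tu.
  apply: (IH a ab (ltW ak) u (fun z => I (act h (act (shift a) z))) Pu).
    by move=> v w z Iv Iw jz; apply: (Ijoin' _ _ _ Iv Iw); exact: join_shift.
  move=> v v2 vu; apply: Iatom' => //; apply/(lay_le_node _ ge); split.
    by constructor 2; exists v => //; exact: (exh_lower ex Tu vu).
  apply: le_trans ue; apply: (@lay_le_gr (osucc a)); first by rewrite le_osucc.
  by apply: (act_le _ (mmap_shift ak) vu); rewrite le_osucc.
Qed.

(** * Cardinality of the top layer *)

Lemma card_layer : lay kappa #= below (aleph 2).
Proof.
have gk := good_all (lexx kappa).
have [_ _ tk] := morass_P0a MF; rewrite card_eq_le; apply/andP; split; last first.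
  (* Lower bound: every grade below [aleph 2] occurs. *)
  have /choice [s sP] (g : Ord) : exists x, g < aleph 2 -> lay kappa x /\ x.1 = g.
    have [gt|] := pselect (g < aleph 2); last by exists (g, None).
    by move: (gt); rewrite -[aleph 2]tk => /(lay_surj gk) [x Px xg]; exists x.
  apply: (card_le_inj (f := s)) => [g /sP[]//|g g' /sP[_ eg] /sP[_ eg'] e].
  by rewrite -eg e.
(* Upper bound, in two steps: the points up to a given grade must number at most [aleph 1], and this
   follows by ranking them in [aleph 1] with countable initial parts. *)
apply: (card_le_csucc (g := fst)) => y /layer_lt; rewrite tk => /lt_csucc.
move=> /(card_le_injP (ofin 0)) [j0 j0k j0i].
(* An injection of the grades up to [y.1] into [kappa]; the successor frees the value 0 for [y.1]
   itself. *)
pose j g := if g < y.1 then osucc (j0 g) else ofin 0.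
have osucc0 (o : Ord) : osucc o <> ofin 0.
  by move=> e; have := lt_osucc o; rewrite e ltNge ofin0_le.
have k0 : ofin 0 < kappa.
  have [_ ok] := morass_kappa MF; apply: lt_le_trans ok.
  by apply/lt_omega; exists 0%N.
have jk g : j g < kappa.
  by rewrite /j; case: ifP => // gy; exact: osucc_lt_aleph1 (j0k _ gy).
have ji g g' : g <= y.1 -> g' <= y.1 -> j g = j g' -> g = g'.
  rewrite /j !le_eqVlt; case: ifP => [gy|_]; case: ifP => [gy'|_].
  - by move=> _ _ /osucc_inj; exact: j0i.
  - by move=> _ _ /osucc0.
  - by move=> _ _ /esym /osucc0.
  - by rewrite !orbF => /eqP -> /eqP ->.
have birthk z : lay kappa z -> birth z.2 < kappa.
  move=> /lay_birth; case: z.2 => [[a n]|] /=; last by [].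
  by rewrite le_osucc; exact: osucc_lt_aleph1.
apply: (card_le_csucc (g := fun x => Order.max (j x.1) (birth x.2))) => x [Px /= xy].
set o := Order.max _ _.
have ok : o < kappa by rewrite /o gt_max jk birthk.
apply: card_le_trans card_nat_omega.
(* A point is determined by the value of [j] at its grade and by its tag; both range over countable
   sets once bounded by [o]. *)
apply: (@sub_countable _ _ _ (below (osucc o) `*` [set c | birth c <= o])).
  apply: (card_le_inj (f := fun z => (j z.1, z.2))) => [z [_ /=]|].
    by rewrite ge_max => /andP[jo bo]; split=> //; rewrite /below /= lt_osuccE.
  by move=> [g c] [g' c'] [[_ /= gy] _] [[_ /= g'y] _] [/ji -> // ->].
by apply: countableX; [exact: countable_below (osucc_lt_aleph1 ok) | exact: countable_birth].
Qed.

(** * The top layer as an atomistic 3-ladder *)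

Lemma ladder_of_morass : exists (d : Order.disp_t) (L : bLatticeType d),
  [/\ is_ladder 3 L, atomistic L & [set: L] #= below (aleph 2)].
Proof.
have kk := lexx kappa; have gk := good_all kk.
pose X := set_type (lay kappa).
have XP (x : X) : lay kappa (val x) by exact: set_mem (valP x).
pose mk x (Px : lay kappa x) : X := SigSub (mem_set Px : x \in lay kappa).
pose r (x y : X) := `[< lle kappa (val x) (val y) >].
have P0 : lay kappa (ofin 0, None).
  have [x Px _] := lay_surj gk (theta_gt0 kk).
  exact: (lay_in gk (lay_zero kk Px)).
have rfin x : finite_set [set y | r y x].
  apply: (@sub_finite_set _ _ (val @^-1` [set y | lle kappa y (val x)])).
    by move=> y /asboolP.
  by apply: finite_preimage (lay_fin gk (XP x)) => u v _ _; exact: val_inj.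
have [||||x y|d [L [f [[g fK gK] fr]]]] := @lower_finite_lattice X r (mk _ P0) _ _ _ _ rfin.
- by move=> x; apply/asboolP; exact: (lay_refl gk).
- by move=> x y /andP[/asboolP xy /asboolP yx]; apply: val_inj; exact: (lay_anti gk).
- by move=> y x z /asboolP xy /asboolP yz; apply/asboolP; exact: (lay_trans gk xy yz).
- by move=> x; apply/asboolP; exact: (lay_zero kk).
- have [z [xz yz lz] _] := lay_join gk (XP x) (XP y).
  exists (mk z (lay_le_layer xz)) => w; apply/asboolP/andP => [zw|[/asboolP xw /asboolP yw]].
    by split; apply/asboolP; [exact: (lay_trans gk xz) | exact: (lay_trans gk yz)].
  exact: lz.
have fle x y : (f x <= f y) <-> lle kappa (val x) (val y).
  by rewrite fr; split=> [/asboolP//|?]; exact/asboolP.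
have f0 : f (mk _ P0) = \bot.
  by apply: le_anti; rewrite le0x andbT -[\bot]gK; apply/fle; exact: (lay_zero kk).
have coverE x y : lower_cover (f x) (f y) -> lay_cover kappa (val x) (val y).
  move=> [/[dup] /ltW /fle xy lxy nz]; split=> //.
    by move=> /val_inj e; rewrite e ltxx in lxy.
  move=> z xz zy; have Pz := lay_in gk zy.
  apply: contrapT => /not_orP [zx zy']; apply: nz; exists (f (mk _ Pz)).
  rewrite !lt_neqAle; apply/andP; split; apply/andP; split; try exact/fle.
    by apply/eqP => /(can_inj fK) e; apply: zx; rewrite e.
  by apply/eqP => /(can_inj fK) e; apply: zy'; rewrite -e.
exists d, L; split.
- split=> [p|y].
    apply: (sub_finite_set _ (finite_image f (rfin (g p)))) => x /= xp.
    by exists (g x); rewrite ?gK //= -fr !gK.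
  have [D [D3 Dinj]] := lay_covers kk (XP (g y)).
  have toc x : lower_cover x y -> lay_cover kappa (val (g x)) (val (g y)).
    by move=> c; apply: coverE; rewrite !gK.
  (* Each lower cover is sent to the index of a class containing it; elements that are not lower
     covers get 0. *)
  have /choice [i iP] x : exists i, lower_cover x y -> (i < 3)%N /\ D i (val (g x)).
    have [/toc /D3 [i i3 Di]|nc] := pselect (lower_cover x y); first by exists i.
    by exists 0%N.
  apply: (card_le_inj (f := i)) => [x /iP[]//|x x' cx cx' e].
  apply: (can_inj gK); apply: val_inj.
  have [_ Dx] := iP _ cx; have [_ Dx'] := iP _ cx'.
  by apply: (Dinj _ _ _ Dx _ (toc _ cx) (toc _ cx')); rewrite e.
(* The atoms used are the nonzero points tagged [None]. *)
- move=> x; exists [set a | [/\ a <= x, a <> \bot & (val (g a)).2 = None]].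
    move=> u [_ u0 u2]; split; first by rewrite lt0x; apply/eqP.
    move=> [z /andP[z0 zu]]; have : lle kappa (val (g z)) (val (g u)).
      by apply/fle; rewrite !gK; exact: ltW.
    move=> /(lay_atom_le kk u2) [e|/val_inj /(can_inj gK) e]; last by rewrite e ltxx in zu.
    have e0 : g z = mk _ P0 by exact: val_inj.
    by move: z0; rewrite -[z]gK e0 f0 ltxx.
  split=> [u [] //|w wub]; suff H : lle kappa (val (g x)) (val (g w)).
    by rewrite -[x]gK -[w]gK; exact/fle.
  apply: (lay_atomistic kk (I := fun u => lle kappa u (val (g w))) (XP (g x))).
    by move=> u v z uw vw [_ _]; apply.
  move=> u u2 ux; have Pu := lay_in gk ux.
  (* The zero also carries the tag [None] but is not among these atoms; it lies below [w] anyway. *)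
  have [e0|n0] := pselect (f (mk u Pu) = \bot).
    have -> : u = (ofin 0, None) by rewrite -[u]/(val (mk u Pu)) -[mk u Pu]fK e0 -f0 fK.
    exact: lay_zero.
  have : f (mk u Pu) <= w.
    by apply: wub; split=> //; [rewrite -[x]gK; exact/fle | rewrite fK].
  by rewrite -[w in _ <= w]gK => /fle.
- have fb : set_bij [set: X] [set: L] f.
    split=> //; first by move=> u v _ _; exact: (can_inj fK).
    by move=> u _; exists (g u).
  rewrite card_eq_sym; apply: card_eq_trans (_ : below (aleph 2) #= [set: X]) _.
    by rewrite card_eq_sym; apply: card_eq_trans card_layer; exact: card_setT.
  by apply: pcard_eq; exact: fb.
Qed.

End Morass.

Theorem theorem9p1 :
  (exists (theta : Ord -> Ord)
          (F : forall a b, set (below (theta a) -> below (theta b))),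
     simplified_morass (aleph 1) theta F) ->
  exists (d : Order.disp_t) (L : bLatticeType d),
    [/\ is_ladder 3 L, atomistic L & [set: L] #= below (aleph 2)].
Proof. by move=> [theta [F MF]]; exact: ladder_of_morass MF. Qed.
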